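(* Let $\phi,\varphi:[0,\infty)\to[0,\infty)$, where $\phi$ is convex, monotonically increasing and satisfies $\phi(xy)\le\varphi(x)\phi(y)$ for all $x,y\ge 0$. Let $F,F_1:(0,\infty)\times\mathbb{R}\to(0,\infty)$, let $p,q\in\mathcal{P}(\mathbb{R})$ satisfy $1/p(x)+1/q(x)=1$, let $(R(t))_{t>0}\subseteq L(X,Y)$ be a strongly continuous operator family, and let $(a_k)_{k\ge 0}$ be a sequence of positive real numbers with $\sum_{k=0}^\infty a_k=1$. Let $g:\mathbb{R}\to X$ be such that $\check g$ is measurable, and suppose that for every $x\in\mathbb{R}$ $$\int_{-x}^\infty\|R(v+x)\|\,\|\check g(v)\|\,dv<\infty .$$ Suppose also that for every $x\in\mathbb{R}$ and $l>0$ $$H(l,x):=\sum_{k=0}^\infty a_k\,\varphi(la_k^{-1})\,\bigl\|\varphi(\|R(v+x)\|)\bigr\|_{L^{q(v)}[-x+kl,-x+(k+1)l]}\,F(l,-x+lk)^{-1}<\infty .$$ Consider the inequality $$( * )\qquad \int_t^{t+l}\varphi_{p(x)}\Bigl(2l^{-1}H(l,x)F_1(l,t)\Bigr)\,dx\le 1 .$$ (a) If $\check g$ is equi-Weyl-$(p,\phi,F)$-almost periodic and $( * )$ holds for every $t\in\mathbb{R}$ and $l>0$, then the function $G:\mathbb{R}\to Y$, $G(x):=\int_{-\infty}^xR(x-s)g(s)\,ds$, is well-defined and equi-Weyl-$(p,\phi,F_1)$-almost periodic. (b) If $\check g$ is Weyl-$(p,\phi,F)$-almost periodic and there exists $l_0>0$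 such that $( * )$ holds for all $l\ge l_0$ and $t\in\mathbb{R}$, then $G$ is well-defined and Weyl-$(p,\phi,F_1)$-almost periodic.
   Context: $X,Y$ are complex Banach spaces; $L(X,Y)$ is the space of bounded linear operators from $X$ to $Y$; $\check g(t):=g(-t)$. For $\Omega\subseteq\mathbb{R}$, $\mathcal{P}(\Omega)$ is the set of Lebesgue measurable $p:\Omega\to[1,\infty]$ (with $1/\infty=0$). For $t\ge 0$: $\varphi_{p(x)}(t)=t^{p(x)}$ if $p(x)<\infty$; if $p(x)=\infty$, $\varphi_{p(x)}(t)=0$ for $0\le t\le 1$ and $\varphi_{p(x)}(t)=\infty$ for $t>1$. (The indexed $\varphi_{p(x)}$ is not related to the function $\varphi$.) A measurable $u$ on $\Omega$ belongs to $L^{p(x)}(\Omega)$ iff $\int_\Omega\varphi_{p(x)}(\lambda\|u(x)\|)dx<\infty$ for some $\lambda>0$, and $\|u\|_{L^{p(\cdot)}(\Omega)}=\inf\{\lambda>0:\int_\Omega\varphi_{p(x)}(\|u(x)\|/\lambda)\,dx\le 1\}$. On subintervals the restriction of $p$ is used; in $\|\cdot\|_{L^{q(v)}[a,b]}$ the variable is $v$. Let $p\in\mathcal{P}(\mathbb{R})$, $\phi:[0,\infty)\to[0,\infty)$, $F:(0,\infty)\times\mathbb{R}\to(0,\infty)$, let $Z$ be a Banach space, and let $f:\mathbb{R}\to Z$ be such that $\phi(\|f(\cdot+\tau)-f(\cdot)\|)\in L^{p(x)}(K)$ for every $\tau\in\mathbb{R}$ and compact $K\subseteq\mathbb{R}$.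 Then $f$ is: - equi-Weyl-$(p,\phi,F)$-almost periodic iff for each $\epsilon>0$ there are $l>0$, $L>0$ such that every interval $I'\subseteq\mathbb{R}$ of length $L$ contains $\tau$ with $\sup_{t\in\mathbb{R}}F(l,t)\,\bigl\|\phi(\|f(\cdot+\tau)-f(\cdot)\|)\bigr\|_{L^{p(\cdot)}[t,t+l]}\le\epsilon$; - Weyl-$(p,\phi,F)$-almost periodic iff for each $\epsilon>0$ there is $L>0$ such that every interval $I'\subseteq\mathbb{R}$ of length $L$ contains $\tau$ with $\limsup_{l\to\infty}\sup_{t\in\mathbb{R}}F(l,t)\,\bigl\|\phi(\|f(\cdot+\tau)-f(\cdot)\|)\bigr\|_{L^{p(\cdot)}[t,t+l]}\le\epsilon$.
   Formalization: Almost periodicity of G means the defining ε-condition only (norm infinite outside the space); the standing requirement that φ(‖G(·+τ)−G‖) lie in L^{p(x)}(K) for every τ and compact K is not claimed, since it can fail under the stated hypotheses. *)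

(* Defs.v *)
From HB Require Import structures.
From mathcomp Require Import all_boot all_order all_algebra.
From mathcomp Require Import all_classical all_reals all_analysis.
From mathcomp Require Import measurable_realfun complex.

Set Implicit Arguments.
Unset Strict Implicit.
Unset Printing Implicit Defensive.

Import Order.TTheory GRing.Theory Num.Theory.
Import numFieldNormedType.Exports.

Local Open Scope classical_set_scope.
Local Open Scope complex_scope.
Local Open Scope ring_scope.

(* The real line with the Lebesgue (not merely Borel) sigma-algebra. *)
Notation lebesgueR R :=
  (@caratheodory_type R (ocitv_type R) ((wlength (@idfun R))^*)%mu).
Notation leb := completed_lebesgue_measure.

Section Banach.
Context {R : realType}.

(* The norm of a complex normed module takes its values in R[i]; it is real. *)
Definition rnorm (V : normedModType R[i]) (v : V) : R := complex.Re `|v|.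

Definition bounded_operator (X Y : normedModType R[i])
    (A : {linear X -> Y}) : Prop :=
  exists M : R, forall x, rnorm (A x) <= M * rnorm x.

Definition opnorm (X Y : normedModType R[i]) (A : {linear X -> Y}) : R :=
  sup [set rnorm (A x) | x in [set x | rnorm x <= 1]].

(* A strongly continuous family (T t)_{t > 0} in L(X, Y); T t is irrelevant
   for t <= 0. *)
Definition strongly_continuous_family (X Y : normedModType R[i])
    (T : R -> {linear X -> Y}) : Prop :=
  (forall t, 0 < t -> bounded_operator (T t)) /\
  (forall x t, 0 < t -> {for t, continuous (fun s : R => T s x)}).

End Banach.

Section Bochner.
Context {R : realType} {V : normedModType R[i]}.
Implicit Types (D : set R) (f s : R -> V).

Definition simple_function s : Prop :=
  finite_set (range s) /\
  forall v : V, measurable (s @^-1` [set v] : set (lebesgueR R)).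

(* Measurability of Banach-valued functions is Bochner measurability. *)
Definition strongly_measurable f : Prop :=
  exists s : nat -> R -> V,
    (forall n, simple_function (s n)) /\
    {ae leb, forall x : lebesgueR R, s n x @[n --> \oo] --> f x}.

Definition simple_integral D s : V :=
  \sum_(v \in range s)
    (fine (leb (D `&` s @^-1` [set v] : set (lebesgueR R))))%:C *: v.

Definition bochner_approx D f (s : nat -> R -> V) : Prop :=
  [/\ forall n, simple_function (s n),
      forall n (v : V), v != 0 ->
        (leb (D `&` s n @^-1` [set v] : set (lebesgueR R)) < +oo)%E,
      {ae leb, forall x : lebesgueR R, D x -> s n x @[n --> \oo] --> f x} &
      (\int[leb]_(x in D) (rnorm (f x - s n x))%:E)%E
        @[n --> \oo] --> (0 : \bar R)%E].

Definition bochner_integrable D f : Prop :=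
  exists s : nat -> R -> V, bochner_approx D f s.

(* Defaults to 0 when f is not Bochner integrable on D. *)
Definition bochner_integral D f : V :=
  xget 0 [set y : V | exists2 s : nat -> R -> V, bochner_approx D f s &
                        simple_integral D (s n) @[n --> \oo] --> y].

End Bochner.

Section VariableExponent.
Context {R : realType}.
Implicit Types (D : set R) (p q : R -> \bar R) (u : R -> R).

Definition exponent p : Prop :=
  measurable_fun [set: lebesgueR R] p /\ forall x, (1 <= p x)%E.

(* Only used for 1 <= r <= +oo and 0 <= t. *)
Definition varphi (r : \bar R) (t : R) : \bar R :=
  match r with
  | r'%:E => (t `^ r')%:E
  | +oo%E => if t <= 1 then 0%E else +oo%E
  | -oo%E => 0%E
  end.

Definition modular D p u : \bar R := (\int[leb]_(x in D) varphi (p x) (u x))%E.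

Definition in_Lp D p u : Prop :=
  measurable_fun (D : set (lebesgueR R)) u /\
  exists2 lam : R, 0 < lam & (modular D p (fun x => (lam * `|u x|)%R) < +oo)%E.

(* The Luxemburg norm on L^{p(x)}(D), extended by +oo (the infimum of the empty
   set) to functions outside this space; hence the measurability clause. *)
Definition Lp_norm D p u : \bar R :=
  ereal_inf [set lam%:E | lam in
    [set lam : R | [/\ measurable_fun (D : set (lebesgueR R)) u, 0 < lam &
                     (modular D p (fun x => (`|u x| / lam)%R) <= 1)%E]]].

End VariableExponent.

Section Weyl.
Context {R : realType} {Z : normedModType R[i]}.
Variables (p : R -> \bar R) (phi : R -> R) (F : R -> R -> R).
Implicit Types (f : R -> Z) (tau l : R).

Definition phi_diff f tau : R -> R := fun x => phi (rnorm (f (x + tau) - f x)).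

(* The standing assumption on f under which almost periodicity is considered.
   It is kept apart from the two defining conditions below, which make sense
   without it because Lp_norm is +oo outside L^{p(x)}. In particular the bounds
   in those conditions force phi_diff f tau into L^{p(x)} of the intervals
   [t, t + l] involved, but only for the almost periods tau; for a convolution
   against a variable exponent the assumption can fail at other tau. *)
Definition weyl_admissible f : Prop :=
  forall tau (K : set R), compact K -> in_Lp K p (phi_diff f tau).

Definition weyl_sup f tau l : \bar R :=
  ereal_sup [set ((F l t)%:E * Lp_norm `[t, (t + l)%R] p (phi_diff f tau))%E
            | t in [set: R]].

Definition equi_weyl_ap f : Prop :=
  forall eps : R, 0 < eps ->
  exists l L : R, [/\ 0 < l, 0 < L &
    forall I : set R, is_interval I -> leb (I : set (lebesgueR R)) = L%:E ->
    exists2 tau, I tau & (weyl_sup f tau l <= eps%:E)%E].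

Definition weyl_ap f : Prop :=
  forall eps : R, 0 < eps ->
  exists2 L : R, 0 < L &
    forall I : set R, is_interval I -> leb (I : set (lebesgueR R)) = L%:E ->
    exists2 tau, I tau & (limf_esup (weyl_sup f tau) +oo%R <= eps%:E)%E.

End Weyl.

Section Convolution.
Context {R : realType} {X Y : normedModType R[i]}.
Variable T : R -> {linear X -> Y}.

Definition reflection (g : R -> X) : R -> X := fun t => g (- t).

Definition convolution_integrable (g : R -> X) : Prop :=
  forall x, bochner_integrable `]-oo, x[ (fun s => T (x - s) (g s)).

Definition convolution (g : R -> X) : R -> Y :=
  fun x => bochner_integral `]-oo, x[ (fun s => T (x - s) (g s)).

Definition Hsum (vphi : R -> R) (F : R -> R -> R) (q : R -> \bar R)
    (a : nat -> R) (l x : R) : \bar R :=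
  (\sum_(0 <= k <oo)
     (a k * vphi (l * (a k)^-1))%:E *
     Lp_norm `[(- x + k%:R * l)%R, (- x + k.+1%:R * l)%R] q
       (fun v => vphi (opnorm (T (v + x)%R))) *
     ((F l (- x + l * k%:R))^-1)%:E)%E.

End Convolution.

(* Main.v *)
Require Import Defs.
From HB Require Import structures.
From mathcomp Require Import all_boot all_order all_algebra.
From mathcomp Require Import all_classical all_reals all_analysis.
From mathcomp Require Import measurable_realfun complex.
From mathcomp Require Import ring lra.

Set Implicit Arguments.
Unset Strict Implicit.
Unset Printing Implicit Defensive.

Import Order.TTheory GRing.Theory Num.Theory.
Import numFieldNormedType.Exports.

Local Open Scope classical_set_scope.
Local Open Scope complex_scope.
Local Open Scope ring_scope.

(** Write g~(v) = g(-v) and G for the convolution. The substitution v = -s turns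
   G(x) into the Bochner integral of T(v+x) g~(v) over the half-line v > -x, and a
   translation of the variable turns G(x+tau) into the integral of
   T(v+x) g~(v-tau) over the same half-line. Hence |G(x+tau) - G(x)| is at most the
   integral of w(v) = |T(v+x)| |g~(v-tau) - g~(v)| over v > -x
   ([rnorm_convolution_diff_le]).

   Cut that half-line into cells of length l and give the k-th cell the mass a_k,
   spread uniformly. This is a probability measure, for which the integral of w is
   the mean of the function equal to (l / a_k) w on the k-th cell. Jensen's
   inequality ([jensen_series]) bounds phi(integral of w) by the sum of
   (a_k / l) times the integral over the k-th cell of phi((l / a_k) w). The
   hypothesis phi(xy) <= vphi(x) phi(y), used twice, splits the integrand into
   vphi(l / a_k), vphi(|T(v+x)|) and phi(|g~(v-tau) - g~(v)|); Hoelder's inequality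
   with constant 2 ([hoelder_variable]) separates the last two; and if -tau is an
   eps-almost period of g~ at scale l, the factor coming from g~ is at most eps / F
   on each cell ([cell_estimate]). Altogether
   phi(|G(x+tau) - G(x)|) <= (2 / l) eps H(l,x)
   ([phi_convolution_diff_le]). The hypothesis on H and F1 says that (2 / l) H(l,.)
   has Luxemburg norm at most 1 / F1(l,t) on [t,t+l], so tau is an eps-almost period
   of G at scale l ([weyl_sup_convolution]). Both statements follow: for the first
   one a single l is used, for the second one all large l.

   Two things remain: G has to exist as a Bochner integral, and
   x |-> |G(x+tau) - G(x)| has to be Lebesgue measurable, since the Luxemburg norm of
   a non-measurable function is infinite. One construction gives both
   ([convolution_approximants]). In T(v+x) g~(v), replace g~ by a simple function
   dominated by 2 |g~|, and T(v+x) by its value at the next point of a fine grid, or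
   by 0 when v+x is outside [1/m, m]. For every x at once this is a simple function
   of v which approximates the integrand in the sense of Bochner; and its integral
   depends on x only through the measures of A `&` ]al - x, be - x] for finitely many
   sets A, which are Lipschitz functions of x. So x |-> |G(x+tau) - G(x)| is a
   pointwise limit of Lipschitz functions. *)

(** * Lebesgue measurable sets and functions *)

Section LebesgueMeasure.
Context {R : realType}.
Notation lebR := (lebesgueR R).
Implicit Types (A B D : set R).

Lemma borel_measurable_leb A :
  measurable (A : set (measurableTypeR R)) -> measurable (A : set lebR).
Proof. exact: sub_caratheodory. Qed.

Lemma leb_borelE A : leb (A : set lebR) = lebesgue_measure (A : set (measurableTypeR R)).
Proof. by []. Qed.

Lemma measurable_itv_leb (i : interval R) : measurable ([set` i] : set lebR).
Proof. by apply: borel_measurable_leb; exact: measurable_itv. Qed.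

Lemma open_measurable_leb A : open A -> measurable (A : set lebR).
Proof. by move=> oA; apply: borel_measurable_leb; exact: open_measurable. Qed.

Lemma borel_measurable_fun_leb (f : R -> R) :
  measurable_fun setT (f : measurableTypeR R -> measurableTypeR R) ->
  measurable_fun setT (f : lebR -> measurableTypeR R).
Proof.
by move=> mf _ B mB; apply: borel_measurable_leb; exact: mf.
Qed.

(** The Lebesgue sigma-algebra is the completion of the Borel one: this is how
   statements about Borel sets are transferred to Lebesgue measurable sets. *)
Lemma leb_decomp A : measurable (A : set lebR) ->
  exists2 X, measurable (X : set (measurableTypeR R)) &
    exists2 N, (@lebesgue_measure R).-negligible N & X `|` N = A.
Proof.
move=> mA; have : (completed_algebra_gen (@lebesgue_measure R)).-sigma.-measurable A.
  by rewrite completed_caratheodory_measurable.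
by rewrite g_sigma_completed_algebra_genE => -[X mX [N negN <-]]; exists X => //; exists N.
Qed.

Lemma negligible_leb A : (@lebesgue_measure R).-negligible A ->
  leb.-negligible (A : set lebR).
Proof.
by move=> [B [mB B0 AB]]; exists B; split => //; exact: borel_measurable_leb.
Qed.

Definition measure_preserving (psi : R -> R) := forall A,
  measurable (A : set lebR) ->
  measurable (psi @^-1` A : set lebR) /\ leb (psi @^-1` A : set lebR) = leb (A : set lebR).

(** Preimages of Borel null sets are null, so a map that preserves the measure of
   Borel sets also preserves Lebesgue measurability and the completed measure. *)
Lemma borel_measure_preserving (psi : R -> R) :
  (forall A, measurable (A : set (measurableTypeR R)) ->
    measurable (psi @^-1` A : set (measurableTypeR R)) /\
    lebesgue_measure (psi @^-1` A) = lebesgue_measure A) ->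
  measure_preserving psi.
Proof.
move=> mpsi A mA; have [X mX [N negN XNA]] := leb_decomp mA.
have negpN : (@lebesgue_measure R).-negligible (psi @^-1` N).
  case: negN => B [mB B0 NB]; exists (psi @^-1` B).
  by have [? e] := mpsi _ mB; split => //; [rewrite e|move=> x /NB].
have mneg (M : set R) : (@lebesgue_measure R).-negligible M -> measurable (M : set lebR).
  by move=> /negligible_leb /completed_lebesgue_measure_is_complete.
have lebU (Z M : set R) : measurable (Z : set (measurableTypeR R)) ->
    (@lebesgue_measure R).-negligible M ->
    leb (Z `|` M : set lebR) = leb (Z : set lebR).
  move=> mZ nM; apply: measureU0; [exact: borel_measurable_leb|exact: mneg|].
  by apply/(negligibleP leb (mneg _ nM)); exact: negligible_leb.
have [mpX pX] := mpsi _ mX.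
rewrite -XNA preimage_setU; split.
  by apply: measurableU; [exact: borel_measurable_leb|exact: mneg].
by rewrite !lebU// !leb_borelE.
Qed.

Lemma measure_preserving_reflect (c : R) : measure_preserving (fun x => c - x).
Proof.
apply: borel_measure_preserving => A mA.
have mpsi : measurable_fun setT ((fun x => c - x) : measurableTypeR R -> measurableTypeR R).
  by apply: measurable_funB => //; exact: measurable_id.
split; first by rewrite -[X in measurable X]setTI; exact: mpsi.
pose psi : {mfun (measurableTypeR R) >-> (measurableTypeR R)} := HB.pack (fun x : R => c - x) (isMeasurableFun.Build _ _ _ _ _ mpsi).
rewrite [LHS](_ : _ = pushforward lebesgue_measure psi A)//.
apply/esym/lebesgue_measure_unique => // _ [[a b] _ <-].
rewrite /pushforward [X in _ = lebesgue_measure X](_ : _ = `[c - b, c - a[%classic).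
  by rewrite !lebesgue_measure_itv/= !lte_fin ltrD2l ltrN2; case: ifP => // _;
    rewrite -!EFinB; congr EFin; ring.
apply/seteqP; split => x /=; rewrite !in_itv/= => /andP[].
  by rewrite ltrBrDl -ltrBrDr => -> ; rewrite lerBlDl -lerBlDr => ->.
by rewrite lerBlDl -lerBlDr => -> ; rewrite ltrBrDl -ltrBrDr => ->.
Qed.

Lemma measure_preserving_comp (psi1 psi2 : R -> R) :
  measure_preserving psi1 -> measure_preserving psi2 ->
  measure_preserving (psi1 \o psi2).
Proof.
move=> h1 h2 A mA; have [m1 e1] := h1 _ mA; have [m2 e2] := h2 _ m1.
by rewrite comp_preimage; split => //; rewrite e2.
Qed.

(** A translation is the composite of two reflections. *)
Lemma measure_preserving_shift (c : R) : measure_preserving (fun x => x + c).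
Proof.
rewrite (_ : (fun x => x + c) = (fun x => c - x) \o (fun x => 0 - x)).
  by apply: measure_preserving_comp; exact: measure_preserving_reflect.
by apply/funext => x /=; rewrite sub0r opprK addrC.
Qed.

Lemma measure_preserving_measurable (psi : R -> R) : measure_preserving psi ->
  measurable_fun setT (psi : lebR -> lebR).
Proof. by move=> h _ B mB; rewrite setTI; have [] := h _ mB. Qed.

Lemma measure_preserving_ae (psi : R -> R) (P : set R) : measure_preserving psi ->
  {ae leb, forall x : lebR, P x} -> {ae leb, forall x : lebR, P (psi x)}.
Proof.
move=> h [N [mN N0 PN]]; have [m e] := h _ mN.
by exists (psi @^-1` N); split => //; [exact: etrans e N0|move=> x /= /PN].
Qed.

Lemma measure_preserving_integral (psi : R -> R) D (f : R -> \bar R) :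
  measure_preserving psi -> measurable (D : set lebR) ->
  measurable_fun (D : set lebR) f -> (forall x, D x -> (0 <= f x)%E) ->
  (\int[leb]_(x in psi @^-1` D) f (psi x) = \int[leb]_(x in D) f x)%E.
Proof.
move=> h mD mf f0.
rewrite -(@ge0_integral_pushforward _ _ _ _ _ (psi : lebR -> lebR)
  (measure_preserving_measurable h) leb D f mD mf); last first.
  by move=> x; rewrite inE => /f0.
apply: eq_measure_integral => //=; first exact: measure_preserving_measurable.
by move=> mpsi A mA _; rewrite /pushforward; have [_ ->] := h _ mA.
Qed.

(** The integral of a nonnegative function is a supremum over the simple functions
   below it, so it is monotone without any measurability. This matters because
   x |-> H(l,x) is not assumed to be measurable. *)
Lemma ge0_le_integral_nonmeas D (f g : R -> \bar R) :
  (forall x, D x -> (0 <= f x <= g x)%E) ->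
  (\int[leb]_(x in (D : set lebR)) f x <= \int[leb]_(x in D) g x)%E.
Proof.
move=> fg; rewrite !ge0_integralE//; last 2 first.
- by move=> x /fg/andP[/le_trans]; apply.
- by move=> x /fg/andP[].
apply: le_ereal_sup => _ [h hf <-]; exists h => // x; apply: (le_trans (hf x)).
by apply: lee_restrict => y /fg/andP[].
Qed.

(** Completeness of the measure allows the exceptional null set to be ignored. *)
Lemma ae_cvg_measurable D (u : nat -> R -> R) (v : R -> R) :
  measurable (D : set lebR) ->
  (forall n, measurable_fun (D : set lebR) (u n)) ->
  {ae leb, forall x : lebR, D x -> u n x @[n --> \oo] --> v x} ->
  measurable_fun (D : set lebR) v.
Proof.
move=> mD mu [N [mN N0 cvN]].
pose w : R -> R := v \_ (~` N).
have mw : measurable_fun (D : set lebR) w.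
  apply/(measurable_restrict _ (measurableC mN) mD).
  apply: (@measurable_fun_cvg _ lebR _ _ u) => [m|x [Dx Nx]].
    by apply: measurable_funS (mu m) => // x [].
  by apply: contrapT => h; apply: Nx; apply: cvN => /= /(_ Dx).
apply/measurable_EFinP.
apply: (ae_measurable_fun (@completed_lebesgue_measure_is_complete R) (f := EFin \o w)).
  exists N; split => // x /= h; apply: contrapT => Nx; apply: h => _.
  by rewrite /w patchE mem_set.
exact/measurable_EFinP.
Qed.

End LebesgueMeasure.

(** * The real norm of a complex normed module; finite measurable partitions *)

Section RealNorm.
Context {R : realType} {V : normedModType R[i]}.
Implicit Types (v w : V).

Lemma norm_rnormE v : `|v| = (rnorm v)%:C.
Proof. by rewrite /rnorm RRe_real// ger0_real. Qed.

Lemma rnorm_ge0 v : 0 <= rnorm v.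
Proof. by rewrite -lecR -norm_rnormE; exact: normr_ge0. Qed.

Lemma rnorm0 : rnorm (0 : V) = 0.
Proof. by rewrite /rnorm normr0. Qed.

Lemma rnormN v : rnorm (- v) = rnorm v.
Proof. by rewrite /rnorm normrN. Qed.

Lemma rnorm_distC v w : rnorm (v - w) = rnorm (w - v).
Proof. by rewrite -rnormN opprB. Qed.

Lemma rnorm_triangle v w : rnorm (v + w) <= rnorm v + rnorm w.
Proof. by rewrite -lecR rmorphD/= -!norm_rnormE; exact: ler_normD. Qed.

Lemma rnorm_dist_le (u v w : V) : rnorm (u - w) <= rnorm (u - v) + rnorm (v - w).
Proof. by rewrite (le_trans _ (rnorm_triangle _ _))// addrA subrK. Qed.

Lemma rnormZ (c : R) v : rnorm (c%:C *: v) = `|c| * rnorm v.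
Proof.
apply: complexI; rewrite rmorphM/= -!norm_rnormE normrZ; congr (_ * _).
by rewrite normc_def/= expr0n addr0 sqrtr_sqr.
Qed.

Lemma rnorm_eq0 v : (rnorm v == 0) = (v == 0).
Proof. by rewrite -[RHS]normr_eq0 norm_rnormE -(inj_eq (@complexI R)). Qed.

Lemma rnorm_dist v w : `|rnorm v - rnorm w| <= rnorm (v - w).
Proof.
have h (a b : V) : rnorm a - rnorm b <= rnorm (a - b).
  by rewrite lerBlDr (le_trans _ (rnorm_triangle _ _))// subrK.
by rewrite ler_norml h andbT lerNl opprB rnorm_distC h.
Qed.

Lemma rnorm_sum (I : Type) (r : seq I) (P : pred I) (F : I -> V) :
  rnorm (\sum_(i <- r | P i) F i) <= \sum_(i <- r | P i) rnorm (F i).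
Proof.
elim/big_ind2 : _ => [|v1 x1 v2 x2 h1 h2|//]; first by rewrite rnorm0.
by rewrite (le_trans (rnorm_triangle _ _))// lerD.
Qed.

(** Convergence in a complex normed module is defined with radii in R[i]; only real
   radii matter. *)
Lemma cvg_rnormP {I : Type} {F : set_system I} {FF : Filter F} (u : I -> V) v :
  (u x @[x --> F] --> v) <-> (forall e : R, 0 < e -> \forall x \near F, rnorm (v - u x) < e).
Proof.
split => [/cvgrPdist_lt h e e0|h].
  have /h : 0 < e%:C by rewrite ltcR.
  by apply: filterS => x; rewrite norm_rnormE ltcR.
apply/cvgrPdist_lt => e e0.
have eE : e = (complex.Re e)%:C by rewrite RRe_real// gtr0_real.
have /h : 0 < complex.Re e by rewrite -ltcR -eE.
by apply: filterS => x; rewrite norm_rnormE eE ltcR.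
Qed.

Lemma cvg_rnorm_dist {I : Type} {F : set_system I} {FF : Filter F} (u : I -> V) v :
  (u x @[x --> F] --> v) <-> (rnorm (u x - v) @[x --> F] --> (0 : R)).
Proof.
split => [/cvg_rnormP h|/cvgrPdist_lt h].
  apply/cvgrPdist_lt => e e0; have := h e e0; apply: filterS => x.
  by rewrite sub0r normrN ger0_norm ?rnorm_ge0// rnorm_distC.
apply/cvg_rnormP => e e0; have := h e e0; apply: filterS => x.
by rewrite sub0r normrN ger0_norm ?rnorm_ge0// rnorm_distC.
Qed.

Lemma cvg_rnorm {I : Type} {F : set_system I} {FF : Filter F} (u : I -> V) v :
  u x @[x --> F] --> v -> rnorm (u x) @[x --> F] --> rnorm v.
Proof.
move=> /cvg_rnormP h; apply/cvgrPdist_lt => e e0; have := h e e0; apply: filterS => x.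
exact/le_lt_trans/rnorm_dist.
Qed.

End RealNorm.

Section FinitePartitions.
Context {R : realType}.
Notation lebR := (lebesgueR R).

(** Simple functions with values in an arbitrary set: the fibres cut the line into
   finitely many measurable pieces. Pairing two of them refines the partitions, which
   lets several simple functions be treated on a common partition. *)
Definition finite_partition_map {W : Type} (sigma : R -> W) :=
  finite_set (range sigma) /\
  forall w, measurable (sigma @^-1` [set w] : set lebR).

Lemma finite_partition_preimage {W : choiceType} (sigma : R -> W) (P : set W) :
  finite_partition_map sigma -> measurable (sigma @^-1` P : set lebR).
Proof.
move=> [fs ms].
rewrite (_ : sigma @^-1` P = \bigcup_(w in range sigma `&` P) sigma @^-1` [set w]).
  by apply: fin_bigcup_measurable => //; exact: finite_setIl.
apply/seteqP; split => [x /= Px|x [w [_ Pw] /= ->]//].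
by exists (sigma x) => //; split => //; exists x.
Qed.

Lemma finite_partition_comp {W : choiceType} {U : Type} (sigma : R -> W) (h : W -> U) :
  finite_partition_map sigma -> finite_partition_map (h \o sigma).
Proof.
move=> fs; split => [|u].
  by have := finite_image h fs.1; rewrite image_comp.
by rewrite comp_preimage; exact: finite_partition_preimage.
Qed.

Lemma finite_partition_pair {W U : choiceType} (sigma : R -> W) (tau : R -> U) :
  finite_partition_map sigma -> finite_partition_map tau ->
  finite_partition_map (fun x => (sigma x, tau x)).
Proof.
move=> [fs ms] [ft mt]; split => [|[w u]].
  apply: (sub_finite_set _ (finite_setX fs ft)).
  by move=> _ [x _ <-]; split; exists x.
rewrite (_ : _ @^-1` _ = sigma @^-1` [set w] `&` tau @^-1` [set u]).
  exact: measurableI.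
by apply/seteqP; split => x /= [] ->// ->.
Qed.

Lemma finite_partition_measurable (s : R -> R) : finite_partition_map s ->
  measurable_fun setT (s : lebR -> _).
Proof. by move=> fs _ B mB; rewrite setTI; exact: finite_partition_preimage. Qed.

Lemma finite_partition_bool (A : set R) : measurable (A : set lebR) ->
  finite_partition_map (fun x => x \in A).
Proof.
move=> mA; split=> [|b]; first exact: finite_finset.
case: b.
  by rewrite (_ : _ @^-1` _ = A)//; apply/seteqP; split => x /=; [exact: set_mem|exact: mem_set].
rewrite (_ : _ @^-1` _ = ~` A); first exact: measurableC.
by apply/seteqP; split => x /=; [move=> xA Ax; rewrite mem_set in xA|exact: memNset].
Qed.

Lemma leb_partition {W : choiceType} (sigma : R -> W) (D : set R) (P : set W) (B : set W) :
  measurable (D : set lebR) -> finite_partition_map sigma ->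
  finite_set B -> P `<=` B ->
  leb (D `&` sigma @^-1` P : set lebR) =
  (\sum_(w \in B) if w \in P then leb (D `&` sigma @^-1` [set w] : set lebR) else 0)%E.
Proof.
move=> mD fs fB PB.
rewrite (_ : D `&` _ = \bigcup_(w in P) (D `&` sigma @^-1` [set w])); last first.
  apply/seteqP; split => [x [Dx Px]|x [w Pw [Dx /= xw]]].
    by exists (sigma x).
  by split => //=; rewrite xw.
rewrite measure_fin_bigcup//; first last.
- by move=> w _; apply: measurableI => //; exact: finite_partition_preimage.
- by move=> w1 w2 _ _ [x [[_ /= <-] [_ /= <-]]].
- exact: sub_finite_set PB fB.
rewrite -[in LHS](setIidr PB) fsbig_mkcondr//.
Qed.

End FinitePartitions.

(** * Integrals of simple functions *)

Section BochnerTheory.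
Context {R : realType} {V : normedModType R[i]}.
Notation lebR := (lebesgueR R).
Implicit Types (D : set R) (s f : R -> V).

Lemma simple_function_comp {W : choiceType} (sigma : R -> W) (h : W -> V) :
  finite_partition_map sigma -> simple_function (h \o sigma).
Proof. exact: finite_partition_comp. Qed.

Lemma simple_functionB s s' : simple_function s -> simple_function s' ->
  simple_function (fun x => s x - s' x).
Proof.
move=> fs fs'.
exact: (simple_function_comp (fun w => w.1 - w.2) (finite_partition_pair fs fs')).
Qed.

(** For a simple function, finiteness of the nonzero level sets amounts to finiteness
   of the support, a condition that is easier to combine. *)
Lemma finite_levelsP D s : measurable (D : set lebR) -> simple_function s ->
  (forall v : V, v != 0 -> (leb (D `&` s @^-1` [set v] : set lebR) < +oo)%E) <->
  (leb (D `&` s @^-1` [set~ 0%R] : set lebR) < +oo)%E.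
Proof.
move=> mD ss; split=> [fin|fin v v0]; last first.
  apply: le_lt_trans fin; apply: le_measure; rewrite ?inE.
  - by apply: measurableI => //; have [_] := ss.
  - by apply: measurableI => //; exact: finite_partition_preimage.
  - by move=> x [Dx /= ->]; split => //=; exact/eqP.
rewrite (_ : s @^-1` [set~ 0] = s @^-1` (range s `&` [set~ 0])); last first.
  by apply/seteqP; split => x /=; [move=> s0; split => //; exists x|move=> []].
rewrite (leb_partition mD ss ss.1)//.
rewrite fsbig_finite; last exact: ss.1.
apply: lte_sum_pinfty => v _; case: ifPn => // /set_mem [_ /= /eqP v0].
exact: fin.
Qed.

Lemma fsbig_pick {W : choiceType} (A : set W) (z : W) (c : V) : finite_set A ->
  \sum_(y \in A) (if z == y then c else 0) = if z \in A then c else 0.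
Proof.
move=> fA; case: ifPn => [/set_mem Az|/negP Az].
  rewrite (fsbigD1 z)//= eqxx fsbig1 ?addr0// => y [_ /= yz].
  by case: ifPn => // /eqP zy; rewrite zy in yz.
rewrite fsbig1// => y Ay; case: ifPn => // /eqP zy.
by case: Az; rewrite zy mem_set.
Qed.

(** A simple integral may be computed on any finite partition on which the function
   is constant. The range of h \o sigma groups the pieces with equal values; the extra
   points of B have empty fibres. *)
Lemma simple_integral_comp {W : choiceType} D (sigma : R -> W) (h : W -> V) (B : set W) :
  measurable (D : set lebR) -> finite_partition_map sigma -> finite_set B ->
  range sigma `<=` B ->
  (leb (D `&` (h \o sigma) @^-1` [set~ 0%R] : set lebR) < +oo)%E ->
  simple_integral D (h \o sigma) =
  \sum_(w \in B) (fine (leb (D `&` sigma @^-1` [set w] : set lebR)))%:C *: h w.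
Proof.
move=> mD fs fB rB hfin.
have fh := simple_function_comp h fs.
have hlev := (finite_levelsP mD fh).2 hfin.
pose c w := (fine (leb (D `&` sigma @^-1` [set w] : set lebR)))%:C.
rewrite /simple_integral.
transitivity (\sum_(y \in range (h \o sigma)) \sum_(w \in B)
    (if h w == y then c w *: h w else 0)).
  apply: eq_fsbigr => y _; have [->|y0] := eqVneq y 0.
    by rewrite scaler0 fsbig1// => w _; case: ifPn => // /eqP ->; rewrite scaler0.
  have sE : (h \o sigma) @^-1` [set y] = sigma @^-1` (B `&` h @^-1` [set y]).
    apply/seteqP; split => x /=; last by case.
    by move=> hy; split => //; apply: rB; exists x.
  have fin w : w \in B `&` h @^-1` [set y] ->
      leb (D `&` sigma @^-1` [set w] : set lebR) \is a fin_num.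
    move=> /set_mem [_ /= hwy]; rewrite ge0_fin_numE//.
    apply: le_lt_trans (hlev _ y0); apply: le_measure; rewrite ?inE.
    - by apply: measurableI => //; have [_] := fs.
    - by apply: measurableI => //; have [_] := fh.
    - by move=> x [Dx /= sxw]; split => //=; rewrite sxw.
  rewrite sE (leb_partition mD fs fB)//.
  rewrite !fsbig_finite// -sum_fine; last by move=> w _; case: ifPn => // /fin.
  rewrite rmorph_sum/= scaler_suml big_seq [RHS]big_seq; apply: eq_bigr => w.
  rewrite in_fset_set// => wB; case: ifPn => [/set_mem[_ /= ->]|wn].
    by rewrite eqxx.
  rewrite scale0r; case: ifPn => // /eqP hwy; move: wn.
  by rewrite mem_set//; split => //=; exact: set_mem.
rewrite exchange_fsbig//; last exact: fh.1.
apply: eq_fsbigr => w _; rewrite fsbig_pick//; last exact: fh.1.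
case: ifPn => // hw.
rewrite -/(c w) (_ : c w = 0) ?scale0r// /c (_ : _ `&` _ = set0) ?measure0//.
apply/seteqP; split => x //= [_ sxw]; move/negP: hw; apply; rewrite mem_set//.
by exists x => //=; rewrite sxw.
Qed.

(** Both functions are constant on the partition given by the pair (s, s'). *)
Lemma simple_integralB D s s' : measurable (D : set lebR) ->
  simple_function s -> simple_function s' ->
  (leb (D `&` s @^-1` [set~ 0%R] : set lebR) < +oo)%E ->
  (leb (D `&` s' @^-1` [set~ 0%R] : set lebR) < +oo)%E ->
  (leb (D `&` (fun x => (s x - s' x)%R) @^-1` [set~ 0%R] : set lebR) < +oo)%E /\
  simple_integral D (fun x => s x - s' x) = simple_integral D s - simple_integral D s'.
Proof.
move=> mD ss ss' fin fin'.
have fp := finite_partition_pair ss ss'.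
have fB := finite_setX ss.1 ss'.1.
have rB : range (fun x => (s x, s' x)) `<=` range s `*` range s'.
  by move=> _ [x _ <-]; split; exists x.
have mI (h : V * V -> V) : measurable (D `&` (fun x => h (s x, s' x)) @^-1` [set~ 0%R] : set lebR).
  apply: measurableI => //.
  exact: (finite_partition_preimage (h @^-1` [set~ 0%R]) fp).
have finB : (leb (D `&` (fun x => (s x - s' x)%R) @^-1` [set~ 0%R] : set lebR) < +oo)%E.
  have := lte_add_pinfty fin fin'; apply: le_lt_trans.
  apply: le_trans (measureU2 _ _ _) => /=; [|exact: (mI fst)|exact: (mI snd)].
  apply: le_measure; rewrite ?inE; first exact: (mI (fun w => w.1 - w.2)).
    by apply: measurableU; [exact: (mI fst)|exact: (mI snd)].
  move=> x [Dx /= ss0]; have [s0|] := pselect (s x = 0); last by left.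
  by right; split => //= s'0; apply: ss0; rewrite s0 s'0 subrr.
split => //.
have SE h := @simple_integral_comp _ D (fun x => (s x, s' x)) h _ mD fp fB rB.
rewrite [LHS](SE (fun w => w.1 - w.2))//.
rewrite [X in _ = X - _](SE fst)// [X in _ = _ - X](SE snd)//.
rewrite !fsbig_finite//= -sumrB; apply: eq_bigr => w _.
by rewrite scalerBr.
Qed.

Lemma simple_rnorm_measurable D s : simple_function s ->
  measurable_fun (D : set lebR) (fun x => rnorm (s x)).
Proof.
move=> ss; apply: measurable_funTS; apply: finite_partition_measurable.
exact: (@finite_partition_comp R V R s (@rnorm R V) ss).
Qed.

Lemma rnorm_simple_integral_le D s : measurable (D : set lebR) -> simple_function s ->
  (leb (D `&` s @^-1` [set~ 0%R] : set lebR) < +oo)%E ->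
  ((rnorm (simple_integral D s))%:E <= \int[leb]_(x in (D : set lebR)) (rnorm (s x))%:E)%E.
Proof.
move=> mD ss fin; have lev := (finite_levelsP mD ss).2 fin.
have ms v : measurable (s @^-1` [set v] : set lebR) by have [_] := ss.
rewrite [leRHS](_ : _ = (\sum_(v \in range s) (rnorm v)%:E * leb (D `&` s @^-1` [set v] : set lebR))%E).
  rewrite /simple_integral !fsbig_finite//=; [|exact: ss.1..].
  pose c v := fine (leb (D `&` s @^-1` [set v] : set lebR)).
  suff h (r : seq V) : ((rnorm (\sum_(v <- r) (c v)%:C *: v))%:E <=
    \sum_(v <- r) (rnorm v)%:E * leb (D `&` s @^-1` [set v] : set lebR))%E by exact: h.
  apply: (@le_trans _ _ (\sum_(v <- r) c v * rnorm v)%:E).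
    rewrite lee_fin; apply: le_trans (rnorm_sum _ _ _) _.
    by apply: ler_sum => v _; rewrite rnormZ ger0_norm// fine_ge0.
  rewrite -sumEFin; apply: lee_sum => v _; have [->|v0] := eqVneq v 0.
    by rewrite rnorm0 mulr0 mul0e.
  by rewrite mulrC EFinM fineK// ge0_fin_numE//; exact: lev.
transitivity (\int[leb]_(x in (D : set lebR))
    (\sum_(v \in range s) (rnorm v * \1_(s @^-1` [set v]) x)%:E))%E.
  apply: eq_integral => x _.
  rewrite (fsbigD1 (s x))/=; [|exact: ss.1|by exists x].
  rewrite indicE mem_set// mulr1 fsbig1 ?adde0// => v [_ /= vs].
  by rewrite indicE memNset ?mulr0//= => /esym.
have m1 v : measurable_fun (D : set lebR) (\1_(s @^-1` [set v]) : R -> R).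
  exact: measurable_indic (ms v).
have mf v : measurable_fun (D : set lebR) (fun x => (rnorm v * \1_(s @^-1` [set v]) x)%:E).
  by apply/measurable_EFinP; apply: measurable_funM => //; exact: measurable_cst.
have f0 v x : D x -> (0 <= (rnorm v * \1_(s @^-1` [set v]) x)%:E)%E.
  by move=> _; rewrite lee_fin mulr_ge0// rnorm_ge0.
rewrite (ge0_integral_fsum leb mD mf f0 ss.1).
apply: eq_fsbigr => v _.
under eq_integral do rewrite EFinM.
have m1E : measurable_fun (D : set lebR) (EFin \o (\1_(s @^-1` [set v]) : R -> R)).
  exact/measurable_EFinP.
have f1 x : D x -> (0 <= (EFin \o (\1_(s @^-1` [set v]) : R -> R)) x)%E.
  by move=> _; rewrite /= lee_fin.
rewrite (ge0_integralZl_EFin leb mD f1 m1E (rnorm_ge0 v)).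
by rewrite integral_indic// setIC.
Qed.

Lemma cvge0_lt (u : nat -> \bar R) : u n @[n --> \oo] --> 0%E ->
  forall e : R, 0 < e -> \forall n \near \oo, (u n < e%:E)%E.
Proof.
move=> u0 e e0; have : nbhs (0%E : \bar R) [set x | (x < e%:E)%E].
  by apply: open_nbhs_nbhs; split; [exact: open_ereal_lt_ereal|rewrite /= lte_fin].
by move=> /u0.
Qed.

End BochnerTheory.

(** * The Bochner integral *)

Section BochnerLimits.
Context {R : realType} {V : normedModType R[i]}.
Notation lebR := (lebesgueR R).
Implicit Types (D : set R) (s f : R -> V).

Lemma le_integralD D (h u v : R -> \bar R) : measurable (D : set lebR) ->
  measurable_fun (D : set lebR) u -> measurable_fun (D : set lebR) v ->
  (forall x, D x -> (0 <= h x)%E) ->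
  (forall x, D x -> (0 <= u x)%E) -> (forall x, D x -> (0 <= v x)%E) ->
  (forall x, D x -> (h x <= u x + v x)%E) ->
  (\int[leb]_(x in (D : set lebR)) h x <=
   \int[leb]_(x in (D : set lebR)) u x + \int[leb]_(x in (D : set lebR)) v x)%E.
Proof.
move=> mD mu mv h0 u0 v0 huv.
rewrite -(ge0_integralD leb mD u0 mu v0 mv).
by apply: ge0_le_integral_nonmeas => x Dx; rewrite h0//= huv.
Qed.

Definition simple_limit_on D f := exists2 s : nat -> R -> V,
  forall n, simple_function (s n) &
  {ae leb, forall x : lebR, D x -> s n x @[n --> \oo] --> f x}.

Lemma bochner_approx_simple_limit D f (s : nat -> R -> V) :
  bochner_approx D f s -> simple_limit_on D f.
Proof. by move=> [ss _ cv _]; exists s. Qed.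

Lemma simple_limit_onB D f f' : simple_limit_on D f -> simple_limit_on D f' ->
  simple_limit_on D (fun x => f x - f' x).
Proof.
move=> [s ss cv] [s' ss' cv']; exists (fun n x => s n x - s' n x).
  by move=> n; exact: simple_functionB.
apply: filterS2 cv cv' => x h h' Dx.
by apply: cvgB; [exact: h|exact: h'].
Qed.

Lemma simple_limit_simple D s : simple_function s -> simple_limit_on D s.
Proof.
move=> ss; exists (fun=> s) => //; apply: aeW => x _; exact: cvg_cst.
Qed.

Lemma simple_limit_rnorm_measurable D f : measurable (D : set lebR) ->
  simple_limit_on D f -> measurable_fun (D : set lebR) (fun x => (rnorm (f x))%:E).
Proof.
move=> mD [s ss cv]; apply/measurable_EFinP.
apply: (ae_cvg_measurable (u := fun n x => rnorm (s n x)) mD).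
  by move=> n; exact: simple_rnorm_measurable (ss n).
by apply: filterS cv => x h Dx; apply: cvg_rnorm; exact: h.
Qed.

Lemma rnorm_simple_integralB_le D s s' : measurable (D : set lebR) ->
  simple_function s -> simple_function s' ->
  (leb (D `&` s @^-1` [set~ 0%R] : set lebR) < +oo)%E ->
  (leb (D `&` s' @^-1` [set~ 0%R] : set lebR) < +oo)%E ->
  ((rnorm (simple_integral D s - simple_integral D s'))%:E <=
   \int[leb]_(x in (D : set lebR)) (rnorm (s x - s' x))%:E)%E.
Proof.
move=> mD ss ss' fin fin'; have [finB <-] := simple_integralB mD ss ss' fin fin'.
by apply: rnorm_simple_integral_le => //; exact: simple_functionB.
Qed.

(** The triangle inequality through f and f'. Taking f = f' shows that the simple
   integrals of an approximating sequence form a Cauchy sequence; letting m and n tend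
   to infinity gives the continuity of the integral. *)
Lemma bochner_approx_dist D f f' (s s' : nat -> R -> V) m n :
  measurable (D : set lebR) ->
  bochner_approx D f s -> bochner_approx D f' s' ->
  ((rnorm (simple_integral D (s m) - simple_integral D (s' n)))%:E <=
   \int[leb]_(x in (D : set lebR)) (rnorm (f x - s m x))%:E +
   (\int[leb]_(x in (D : set lebR)) (rnorm (f x - f' x))%:E +
    \int[leb]_(x in (D : set lebR)) (rnorm (f' x - s' n x))%:E))%E.
Proof.
move=> mD As As'.
have lf := bochner_approx_simple_limit As; have lf' := bochner_approx_simple_limit As'.
case: As As' => ss fin _ _ [ss' fin' _ _].
have ls := simple_limit_simple D (ss m); have ls' := simple_limit_simple D (ss' n).
have M g : simple_limit_on D g -> measurable_fun (D : set lebR) (fun x => (rnorm (g x))%:E).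
  exact: simple_limit_rnorm_measurable.
have nn g x : D x -> (0 <= (rnorm (g x : V))%:E)%E by move=> _; rewrite lee_fin rnorm_ge0.
apply: le_trans (rnorm_simple_integralB_le mD (ss m) (ss' n) _ _) _.
- by apply/(finite_levelsP mD (ss m)); exact: fin.
- by apply/(finite_levelsP mD (ss' n)); exact: fin'.
apply: (@le_trans _ _ (\int[leb]_(x in (D : set lebR)) (rnorm (f x - s m x))%:E +
    \int[leb]_(x in (D : set lebR)) (rnorm (f x - s' n x))%:E)%E).
  apply: (le_integralD mD (M _ (simple_limit_onB lf ls)) (M _ (simple_limit_onB lf ls'))
    (nn _) (nn _) (nn _)).
  by move=> x _; rewrite -EFinD lee_fin (rnorm_distC (f x) (s m x)) rnorm_dist_le.
rewrite leeD2l//.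
apply: (le_integralD mD (M _ (simple_limit_onB lf lf')) (M _ (simple_limit_onB lf' ls'))
  (nn _) (nn _) (nn _)).
by move=> x _; rewrite -EFinD lee_fin rnorm_dist_le.
Qed.

(** For f = f' this is the uniqueness of the limit; for the two kernels of a
   convolution on a common half-line it compares G(x + tau) with G(x). *)
Lemma bochner_integral_dist D f f' (s s' : nat -> R -> V) y y' :
  measurable (D : set lebR) ->
  bochner_approx D f s -> bochner_approx D f' s' ->
  simple_integral D (s n) @[n --> \oo] --> y ->
  simple_integral D (s' n) @[n --> \oo] --> y' ->
  ((rnorm (y - y'))%:E <= \int[leb]_(x in (D : set lebR)) (rnorm (f x - f' x))%:E)%E.
Proof.
move=> mD As As' /cvg_rnormP sy /cvg_rnormP sy'.
apply/lee_addgt0Pr => e e0; have e4 : 0 < e / 4 by rewrite divr_gt0.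
have [_ _ _ /cvge0_lt/(_ _ e4) I1] := As.
have [_ _ _ /cvge0_lt/(_ _ e4) I2] := As'.
near \oo => n.
have h1 : rnorm (y - simple_integral D (s n)) < e / 4 by near: n; exact: sy.
have h2 : rnorm (y' - simple_integral D (s' n)) < e / 4 by near: n; exact: sy'.
have h3 : (\int[leb]_(x in (D : set lebR)) (rnorm (f x - s n x))%:E <= (e / 4)%:E)%E.
  by apply: ltW; near: n.
have h4 : (\int[leb]_(x in (D : set lebR)) (rnorm (f' x - s' n x))%:E <= (e / 4)%:E)%E.
  by apply: ltW; near: n.
have h5 := bochner_approx_dist n n mD As As'.
set a := simple_integral D (s n) in h1 h5; set b := simple_integral D (s' n) in h2 h5.
have h6 : rnorm (y - y') <= e / 4 + (rnorm (a - b) + e / 4).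
  rewrite (le_trans (rnorm_dist_le _ a _))// lerD//; first exact: ltW.
  rewrite (le_trans (rnorm_dist_le _ b _))// lerD//.
  by rewrite rnorm_distC ltW.
have {h3 h4}h5 := le_trans h5 (leeD h3 (leeD2l _ h4)).
have : (0 <= \int[leb]_(x in (D : set lebR)) (rnorm (f x - f' x))%:E)%E.
  by apply: integral_ge0 => x _; rewrite lee_fin rnorm_ge0.
move: h5; case: (\int[leb]_(x in (D : set lebR)) (rnorm (f x - f' x))%:E)%E => [r| |]//.
  by rewrite -!EFinD !lee_fin => h5 _; lra.
by move=> _ _; rewrite addye// leey.
Unshelve. all: by end_near.
Qed.

Lemma bochner_integral_unique D f (s : nat -> R -> V) y :
  measurable (D : set lebR) -> bochner_approx D f s ->
  simple_integral D (s n) @[n --> \oo] --> y -> bochner_integral D f = y.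
Proof.
move=> mD As sy; rewrite /bochner_integral.
case: xgetP => [z -> [s' As' sz]|/(_ y)]; last by case; exists s.
have := bochner_integral_dist mD As' As sz sy.
rewrite (_ : (\int[leb]_(x in _) _)%E = 0%E).
  by rewrite lee_fin => zy; apply/eqP; rewrite -subr_eq0 -rnorm_eq0 eq_le zy rnorm_ge0.
by apply: integral0_eq => x _; rewrite subrr rnorm0.
Qed.

End BochnerLimits.

Section BochnerComplete.
Context {R : realType} {V : completeNormedModType R[i]}.
Notation lebR := (lebesgueR R).

Lemma bochner_approx_cvg (D : set R) (f : R -> V) (s : nat -> R -> V) :
  measurable (D : set lebR) -> bochner_approx D f s ->
  simple_integral D (s n) @[n --> \oo] --> bochner_integral D f.
Proof.
move=> mD As; suff /cvg_ex[y sy] : cvgn (fun n => simple_integral D (s n)).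
  by rewrite (bochner_integral_unique mD As sy).
apply: cauchy_cvg; apply: cauchy_exP => e e0.
have eE : e = (complex.Re e)%:C by rewrite RRe_real// gtr0_real.
set d := complex.Re e in eE; have d0 : 0 < d by rewrite -ltcR -eE.
have d2 : 0 < d / 2 by rewrite divr_gt0.
have [_ _ _ /cvge0_lt/(_ _ d2) [N _ I]] := As.
exists (simple_integral D (s N)); exists N => // n Nn.
suff : rnorm (simple_integral D (s N) - simple_integral D (s n)) < d.
  by rewrite -ltcR -norm_rnormE -eE -ball_normE.
rewrite -lte_fin.
apply: le_lt_trans (bochner_approx_dist N n mD As As) _.
rewrite [X in (_ + (X + _))%E](_ : _ = 0%E); last first.
  by apply: integral0_eq => x _; rewrite subrr rnorm0.
rewrite add0e (splitr d) EFinD; apply: lteD; apply: I => //=.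
Qed.

End BochnerComplete.

(** * Change of variables and operator norms *)

Section Transfer.
Context {R : realType} {V : normedModType R[i]}.
Notation lebR := (lebesgueR R).

(** Composition with a measure-preserving map changes neither the level sets' measures
   nor the L1-distances. Values of s n missed by s n \o psi have null level sets. *)
Lemma bochner_approx_transfer (psi : R -> R) (D : set R) (f : R -> V) (s : nat -> R -> V) :
  measurable (D : set lebR) -> measure_preserving psi -> bochner_approx D f s ->
  bochner_approx (psi @^-1` D) (f \o psi) (fun n => s n \o psi) /\
  forall n, simple_integral (psi @^-1` D) (s n \o psi) = simple_integral D (s n).
Proof.
move=> mD mp As; have [ss fin cv I0] := As.
have lE n (v : V) : leb (psi @^-1` D `&` (s n \o psi) @^-1` [set v] : set lebR) =
    leb (D `&` s n @^-1` [set v] : set lebR).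
  have mDs : measurable (D `&` s n @^-1` [set v] : set lebR).
    by apply: measurableI mD _; have [_] := ss n.
  by have [_ <-] := mp _ mDs.
have rs n : range (s n \o psi) `<=` range (s n) by move=> _ [x _ <-]; exists (psi x).
split; last first.
  move=> n; rewrite /simple_integral.
  transitivity (\sum_(v \in range (s n \o psi))
      (fine (leb (D `&` s n @^-1` [set v] : set lebR)))%:C *: v).
    by apply: eq_fsbigr => v _; rewrite lE.
  apply: fsbig_widen; first exact: rs.
  move=> v [_ nv] /=; rewrite -lE (_ : _ `&` _ = set0) ?measure0 ?scale0r//.
  by apply/seteqP; split => x //= [_ sv]; apply: nv; exists x.
split.
- move=> n; split; first by apply: sub_finite_set (rs n) _; have [] := ss n.
  move=> v; have [_ m] := ss n.
  by have [] := mp _ (m v).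
- by move=> n v v0; rewrite lE; exact: fin.
- exact: (measure_preserving_ae (P := fun x => D x -> s n x @[n --> \oo] --> f x) mp cv).
- move: I0; apply: cvg_trans; apply: near_eq_cvg; near=> n => /=.
  have lim : simple_limit_on D (fun x => f x - s n x).
    apply: simple_limit_onB; last exact: simple_limit_simple.
    exact: bochner_approx_simple_limit As.
  rewrite -(measure_preserving_integral mp mD (simple_limit_rnorm_measurable mD lim))//.
  by move=> x _; rewrite lee_fin rnorm_ge0.
Unshelve. all: by end_near.
Qed.

End Transfer.

Section OperatorNorm.
Context {R : realType} {X Y : normedModType R[i]}.
Notation lebR := (lebesgueR R).
Implicit Type A : {linear X -> Y}.

Lemma opnorm_has_sup A : bounded_operator A ->
  has_sup [set rnorm (A x) | x in [set x | rnorm x <= 1]].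
Proof.
move=> [M AM]; split; first by exists (rnorm (A 0)), 0 => //=; rewrite rnorm0.
exists `|M| => _ [x /= x1 <-]; apply: le_trans (AM x) _.
by rewrite (le_trans (ler_norm _))// normrM ler_piMr// ger0_norm ?rnorm_ge0.
Qed.

Lemma opnorm_ge0 A : bounded_operator A -> 0 <= opnorm A.
Proof.
move=> bA; apply: sup_upper_bound; first exact: opnorm_has_sup.
by exists 0; rewrite /= ?linear0 rnorm0.
Qed.

Lemma rnorm_opnorm A x : bounded_operator A -> rnorm (A x) <= opnorm A * rnorm x.
Proof.
move=> bA; have [->|x0] := eqVneq x 0; first by rewrite linear0 !rnorm0 mulr0.
have x1 : 0 < rnorm x by rewrite lt_neqAle eq_sym rnorm_eq0 x0 rnorm_ge0.
rewrite -ler_pdivrMr//; apply: sup_upper_bound; first exact: opnorm_has_sup.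
exists (((rnorm x)^-1)%:C *: x); rewrite /= ?linearZ rnormZ gtr0_norm ?invr_gt0//.
  by rewrite mulVf// gt_eqF.
by rewrite mulrC.
Qed.

Lemma lt_opnorm A c : bounded_operator A -> c < opnorm A ->
  exists2 x, rnorm x <= 1 & c < rnorm (A x).
Proof.
move=> bA cA; have [] := @sup_adherent _ _ (opnorm A - c) _ (opnorm_has_sup bA).
  by rewrite subr_gt0.
by move=> _ [x /= x1 <-]; rewrite subKr => cx; exists x.
Qed.

Lemma lsc_measurable (U : set R) (h : R -> R) : open U ->
  (forall v c, U v -> c < h v -> \forall w \near v, c < h w) ->
  measurable_fun (U : set lebR) h.
Proof.
move=> oU lsc.
apply: (measurability (@RGenOInfty.G R)) => [|/= _ [_ [c ->] <-]].
  exact: RGenOInfty.measurableE.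
apply: open_measurable_leb; rewrite openE => v [Uv].
rewrite /= in_itv/= andbT => cv; apply: filterI.
  by move: oU; rewrite openE => /(_ _ Uv).
by have := lsc _ _ Uv cv; apply: filterS => w; rewrite /= in_itv/= andbT.
Qed.

(** The operator norm is a supremum of the functions v |-> |T(v+x) y|, which are
   continuous where v + x > 0: it is lower semicontinuous there. *)
Lemma opnorm_shift_measurable (T : R -> {linear X -> Y}) x : strongly_continuous_family T ->
  measurable_fun (`]- x, +oo[%classic : set lebR) (fun v => opnorm (T (v + x))).
Proof.
move=> [bT cT]; apply: lsc_measurable => [|v c].
  exact: interval_open.
rewrite /= in_itv/= andbT => xv cv.
have vx0 : 0 < v + x by rewrite addrC -ltrBlDl sub0r.
have [y y1 cy] := lt_opnorm (bT _ vx0) cv.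
have cvg1 : (T (w + x) y) @[w --> v] --> T (v + x) y.
  apply: (@cvg_comp _ _ _ (fun w : R => w + x) (fun s => T s y) _ (nbhs (v + x))).
    by apply: cvgD; [exact: cvg_id|exact: cvg_cst].
  exact: cT.
have lt1 : \forall w \near v, c < rnorm (T (w + x) y).
  exact: (cvgr_gt _ (cvg_rnorm cvg1)).
have lt2 : \forall w \near v, 0 < w + x.
  have h : (w + x) @[w --> v] --> v + x by apply: cvgD; [exact: cvg_id|exact: cvg_cst].
  exact: (cvgr_gt _ h).
apply: filterS2 lt1 lt2 => w cw w0; apply: lt_le_trans cw _.
rewrite (le_trans (rnorm_opnorm _ (bT _ w0)))//.
by rewrite ler_piMr// opnorm_ge0//; exact: bT.
Qed.

(** Compactness is used in the near-covering form, with the filter of the positive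
   numbers tending to 0. *)
Lemma segment_unif_continuous (u : R -> Y) (a b : R) :
  (forall t, a <= t <= b -> {for t, continuous u}) ->
  forall e, 0 < e -> exists2 d, 0 < d & forall r r', a <= r <= b ->
    `|r - r'| < d -> rnorm (u r - u r') < e.
Proof.
move=> cu e e0.
have /compact_near_coveringP/near_covering_withinP := @segment_compact _ a b.
move=> /(_ R (at_right 0) (fun d r => forall r', `|r - r'| < d -> rnorm (u r - u r') < e) _) cov.
have h2 : \forall d \near 0^'+, `[a, b]%classic `<=`
    (fun r => forall r', `|r - r'| < d -> rnorm (u r - u r') < e).
  apply: cov => t; rewrite /= in_itv/= => tab; have e2 : 0 < e / 2 by rewrite divr_gt0.
  have /cvg_rnormP/(_ _ e2) /nbhs_ballP[eta /= eta0 etaP] := cu _ tab.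
  have eta2 : 0 < eta / 2 by rewrite divr_gt0.
  exists (ball t (eta / 2), [set d | d < eta / 2]); first split => /=.
  - exact: nbhsx_ballx.
  - exact: nbhs_right_lt.
  move=> [r d] /= [tr deta] rab r' rr'.
  have h1 : ball t eta r by apply: le_ball tr; lra.
  have h2 : ball t eta r'.
    rewrite /ball/= in tr *; rewrite (splitr eta).
    rewrite (le_lt_trans (ler_distD r _ _))// ltrD// (lt_trans rr')//.
  have := etaP _ h1; have := etaP _ h2 => /= k1 k2.
  rewrite (le_lt_trans (rnorm_dist_le _ (u t) _))// (splitr e) ltrD//.
  by rewrite rnorm_distC.
have : \forall d \near 0^'+, (0 : R) < d by exact: nbhs_right_gt.
move=> h1; have [d [d0 dP]] := @filter_ex _ _ _ _ (filterI h1 h2).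
by exists d => // r r' rab; apply: dP; rewrite /= in_itv.
Qed.

End OperatorNorm.

(** * A truncated grid on the line *)

Section Grid.
Context {R : realType}.
Notation lebR := (lebesgueR R).
Implicit Types (a b d r t : R).

(** The least multiple of d that is at least r. *)
Definition grid d r : R := (Num.ceil (r / d))%:~R * d.

Lemma grid_itv d r : 0 < d -> grid d r - d < r <= grid d r.
Proof.
move=> d0; have /andP[h1 h2] := ceil_itv (r / d); apply/andP; split.
  move: h1; rewrite ltr_pdivlMr// => h1; rewrite (le_lt_trans _ h1)// /grid.
  by rewrite rmorphB/= mulrBl mul1r.
by rewrite -ler_pdivrMr.
Qed.

Lemma grid_fiber d r t : 0 < d -> (grid d r = grid d t) <-> grid d t - d < r <= grid d t.
Proof.
move=> d0; split=> [<-|/andP[h1 h2]]; first exact: grid_itv.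
rewrite /grid; congr (_%:~R * _); apply/eqP; rewrite ceil_eq.
rewrite ltr_pdivlMr// ler_pdivrMr// h2 andbT (le_lt_trans _ h1)// /grid.
by rewrite rmorphB/= mulrBl mul1r.
Qed.

(** The value 0 encodes the outside of [a, b]: since a + d <= grid d r, a nonzero value
   forces r itself, and not only the grid point, to lie in [a, b]. *)
Definition trunc_grid a b d r : R :=
  if (a + d <= grid d r) && (grid d r <= b) then grid d r else 0.

Lemma trunc_grid_neq0 a b d r : 0 < d -> trunc_grid a b d r != 0 ->
  [/\ trunc_grid a b d r = grid d r, a <= r & r <= b].
Proof.
move=> d0; rewrite /trunc_grid; have /andP[h1 h2] := grid_itv r d0.
by case: ifPn => [/andP[h3 h4] _|_]; rewrite ?eqxx//; split => //; lra.
Qed.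

Lemma trunc_grid_finite a b d : 0 <= a -> 0 < d -> finite_set (range (trunc_grid a b d)).
Proof.
move=> a0 d0; pose K := (Num.Def.archi_bound (b / d)).
apply: (@sub_finite_set _ _ [set k%:R * d | k in `I_K.+1]); last first.
  by apply: finite_image; exact: finite_II.
move=> _ [r _ <-]; rewrite /trunc_grid; case: ifPn => [/andP[h1 h2]|_]; last first.
  by exists 0%N => //; rewrite mul0r.
rewrite /grid in h1 h2 *; set c := Num.ceil _ in h1 h2 *.
have c0 : 0 <= c.
  by rewrite -(ler0z R) -(pmulr_lge0 _ d0); lra.
exists `|c|%N; last by rewrite natr_absz ger0_norm.
rewrite /= ltnS -(ler_nat R) natr_absz ger0_norm//.
rewrite -ler_pdivlMr// in h2; apply: (le_trans h2); apply: ltW.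
apply: archi_boundP.
by apply: le_trans h2; rewrite ler0z.
Qed.

(** These intervals are what makes the dependence on a translation explicit: the
   fibre of the translated grid map is the translated interval. *)
Lemma trunc_grid_fiber a b d t : 0 < d -> t != 0 ->
  trunc_grid a b d @^-1` [set t] = set0 \/
  trunc_grid a b d @^-1` [set t] = `]t - d, t]%classic.
Proof.
move=> d0 t0; have [[r rt]|h] := pselect (exists r, trunc_grid a b d r = t); last first.
  by left; apply/seteqP; split => x //= xt; apply: h; exists x.
right; have [rE _ _] : [/\ trunc_grid a b d r = grid d r, a <= r & r <= b].
  by apply: trunc_grid_neq0; rewrite ?rt.
have tE : t = grid d r by rewrite -rE rt.
apply/seteqP; split => x /=; rewrite in_itv/= => xt.
  have [xE _ _] : [/\ trunc_grid a b d x = grid d x, a <= x & x <= b].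
    by apply: trunc_grid_neq0; rewrite ?xt.
  by rewrite tE; apply/(grid_fiber _ _ d0); rewrite -xE xt.
have xE : grid d x = grid d r by apply/(grid_fiber _ _ d0); rewrite -tE.
by rewrite -rt /trunc_grid xE.
Qed.

Lemma trunc_grid_partition a b d : 0 <= a -> 0 < d ->
  finite_partition_map (trunc_grid a b d).
Proof.
move=> a0 d0; have fr := trunc_grid_finite b a0 d0; split => // t.
have m1 u : u != 0 -> measurable (trunc_grid a b d @^-1` [set u] : set lebR).
  move=> u0; have [->|->] := trunc_grid_fiber a b d0 u0; first exact: measurable0.
  exact: measurable_itv_leb.
have [->|/m1//] := eqVneq t 0.
rewrite (_ : _ @^-1` _ = ~` \bigcup_(u in range (trunc_grid a b d) `\ 0)
    trunc_grid a b d @^-1` [set u]).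
  apply: measurableC; apply: fin_bigcup_measurable; first exact: finite_setD.
  by move=> u [_ /= /eqP u0]; exact: m1.
apply/seteqP; split => x /=.
  by move=> x0 [u [_ u0]] /= xu; apply: u0; rewrite -xu.
move=> h; apply: contrapT => x0; apply: h.
by exists (trunc_grid a b d x) => //; split => //; exists x.
Qed.

Lemma finite_partition_preserving {W : Type} (sigma : R -> W) psi :
  measure_preserving psi -> finite_partition_map sigma ->
  finite_partition_map (sigma \o psi).
Proof.
move=> mp [fs ms]; split => [|w]; last by have [] := mp _ (ms w).
by apply: sub_finite_set fs => _ [x _ <-]; exists (psi x).
Qed.

Lemma trunc_grid_shift_partition a b d x : 0 <= a -> 0 < d ->
  finite_partition_map (fun v => trunc_grid a b d (v + x)).
Proof.
move=> a0 d0.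
exact: (finite_partition_preserving (measure_preserving_shift x) (trunc_grid_partition b a0 d0)).
Qed.

Lemma leb_itv (a b : R) (l r : bool) : a <= b ->
  leb ([set` Interval (BSide l a) (BSide r b)] : set lebR) = (b - a)%:E.
Proof.
move=> ab; rewrite leb_borelE lebesgue_measure_itv/= lte_fin.
by case: ltP => // ba; rewrite (_ : b = a) ?subrr//; apply/eqP; rewrite eq_le ab ba.
Qed.

Definition itv_trace (A : set R) (al be x : R) : R :=
  fine (leb (`]al - x, be - x] `&` A : set lebR)).

(** When x increases to x', the interval loses a piece of length x' - x at its right
   end and gains a piece of that length at its left end. *)
Lemma itv_trace_lipschitz (A : set R) (al be x x' : R) :
  measurable (A : set lebR) -> al <= be ->
  `|itv_trace A al be x - itv_trace A al be x'| <= `|x - x'|.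
Proof.
move=> mA alb; pose c := itv_trace A al be; rewrite -!/(c _).
have mc y : measurable (`]al - y, be - y] `&` A : set lebR).
  by apply: measurableI => //; exact: measurable_itv_leb.
have fc y : leb (`]al - y, be - y] `&` A : set lebR) \is a fin_num.
  rewrite ge0_fin_numE//; apply: (@le_lt_trans _ _ (be - al)%:E); last exact: ltry.
  rewrite [leRHS](_ : _ = leb (`]al - y, be - y]%classic : set lebR)).
    apply: le_measure; rewrite ?inE; [exact: mc|exact: measurable_itv_leb|].
    by move=> z [].
  by rewrite leb_itv ?lerD2r//; congr EFin; ring.
have cE y : (c y)%:E = leb (`]al - y, be - y] `&` A : set lebR) by rewrite /c /itv_trace fineK.
have h y z u w : u <= w -> `]al - y, be - y] `<=` `]al - z, be - z] `|` `]u, w] ->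
    c y <= c z + (w - u).
  move=> uw sub; rewrite -lee_fin EFinD !cE -(leb_itv false false uw).
  apply: le_trans (measureU2 _ (mc z) (measurable_itv_leb `]u, w])).
  apply: le_measure; rewrite ?inE; first exact: mc.
    by apply: measurableU; [exact: mc|exact: measurable_itv_leb].
  by move=> v [/sub[]]; [left|right].
have key y z : y <= z -> `|c y - c z| <= z - y.
  move=> yz; rewrite ler_norml; apply/andP; split.
    suff : c z <= c y + (z - y) by lra.
    have := h z y (al - z) (al - y); rewrite lerD2l lerN2 => /(_ yz).
    have -> : al - y - (al - z) = z - y by ring.
    apply=> v /=; rewrite !in_itv/= => /andP[v1 v2].
    by have [v3|v3] := leP v (al - y); [right|left]; apply/andP; split; lra.
  suff : c y <= c z + (z - y) by lra.
  have := h y z (be - z) (be - y); rewrite lerD2l lerN2 => /(_ yz).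
  have -> : be - y - (be - z) = z - y by ring.
  apply=> v /=; rewrite !in_itv/= => /andP[v1 v2].
  by have [v3|v3] := leP v (be - z); [left|right]; apply/andP; split; lra.
have [xx'|/ltW xx'] := leP x x'.
  by rewrite (distrC x) (ger0_norm (_ : 0 <= x' - x)) ?subr_ge0// key.
by rewrite distrC (ger0_norm (_ : 0 <= x - x')) ?subr_ge0// key.
Qed.

End Grid.

(** * Simple approximants of the convolution integrand *)

Section DominatedSimple.
Context {R : realType} {X : normedModType R[i]}.
Notation lebR := (lebesgueR R).

(** Where s n exceeds 2 |f|, replace it by 0. Where s n converges to f <> 0 this
   happens for finitely many n only; where f = 0 the new functions vanish. *)
Lemma dominated_simple_sequence (f : R -> X) : strongly_measurable f ->
  exists s : nat -> R -> X, [/\ forall n, simple_function (s n),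
    {ae leb, forall x : lebR, s n x @[n --> \oo] --> f x} &
    forall n x, rnorm (s n x) <= 2 * rnorm (f x)].
Proof.
move=> [s [ss cv]].
have mf : measurable_fun (setT : set lebR) (fun x => rnorm (f x)).
  apply/measurable_EFinP; apply: simple_limit_rnorm_measurable; first exact: measurableT.
  by exists s => //; apply: filterS cv => x h _.
pose A n := [set x | rnorm (s n x) <= 2 * rnorm (f x)].
have mA n : measurable (A n : set lebR).
  have ms : measurable_fun (setT : set lebR) (fun x => rnorm (s n x)).
    exact: simple_rnorm_measurable (ss n).
  have m2 : measurable_fun (setT : set lebR) (fun x => 2 * rnorm (f x) - rnorm (s n x)).
    by apply: measurable_funB ms; apply: measurable_funM mf; exact: measurable_cst.
  rewrite (_ : A n = setT `&` (fun x => 2 * rnorm (f x) - rnorm (s n x)) @^-1` `[0, +oo[%classic).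
    by apply: m2; [exact: measurableT|exact: measurable_itv].
  by rewrite setTI; apply/seteqP; split => x /=; rewrite in_itv/= andbT subr_ge0.
exists (fun n x => if x \in A n then s n x else 0); split.
- move=> n.
  exact: (simple_function_comp (fun w => if w.2 then w.1 else 0)
    (finite_partition_pair (ss n) (finite_partition_bool (mA n)))).
- apply: filterS cv => x cvx; have [fx0|fx0] := eqVneq (f x) 0.
    rewrite fx0 (_ : (fun n => _) = fun=> 0); first exact: cvg_cst.
    apply/funext => n; case: ifPn => // /set_mem; rewrite /A/= fx0 rnorm0 mulr0 => sn.
    by apply/eqP; rewrite -rnorm_eq0 eq_le sn rnorm_ge0.
  have f0 : 0 < rnorm (f x) by rewrite lt_neqAle eq_sym rnorm_eq0 fx0 rnorm_ge0.
  have f2 : rnorm (f x) < 2 * rnorm (f x) by lra.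
  have near2 : \forall n \near \oo, rnorm (s n x) < 2 * rnorm (f x).
    exact: (cvgr_lt _ (cvg_rnorm cvx)).
  apply: cvg_trans cvx; apply: near_eq_cvg; apply: filterS near2 => n /ltW sn.
  by rewrite mem_set.
- move=> n x; case: ifPn => [/set_mem//|_].
  by rewrite rnorm0 mulr_ge0// rnorm_ge0.
Qed.

End DominatedSimple.

Section ConvolutionApproximants.
Context {R : realType} {X Y : normedModType R[i]}.
Notation lebR := (lebesgueR R).
Variable T : R -> {linear X -> Y}.
Hypothesis T_family : strongly_continuous_family T.

(** Strong continuity is uniform on [a, b] for each of the finitely many values of s. *)
Lemma mesh_exists (s : R -> X) (a b e : R) : simple_function s -> 0 < a -> 0 < e ->
  exists d, [/\ 0 < d, d <= a &
    forall v r r', a <= r <= b -> `|r - r'| <= d -> rnorm (T r (s v) - T r' (s v)) <= e].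
Proof.
move=> [fs _] a0 e0; have /finite_seqP[l lE] := fs.
suff [d [d0 da dP]] : exists d, [/\ 0 < d, d <= a & forall y, y \in l ->
    forall r r', a <= r <= b -> `|r - r'| <= d -> rnorm (T r y - T r' y) <= e].
  exists d; split => // v r r'; apply: dP.
  by have : range s (s v) by [exists v]; rewrite lE.
elim: l {fs lE} => [|y l [d [d0 da dP]]]; first by exists a; split.
have [d1 d10 d1P] : exists2 d, 0 < d & forall r r', a <= r <= b ->
    `|r - r'| < d -> rnorm (T r y - T r' y) < e.
  apply: segment_unif_continuous => // t /andP[at_ _]; apply: T_family.2.
  exact: lt_le_trans at_.
(* halving d1 turns the strict bound on |r - r'| into a weak one *)
exists (Num.min d (d1 / 2)); split.
- by rewrite lt_min d0 divr_gt0.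
- by rewrite ge_min da.
- move=> z; rewrite inE => /predU1P[->|zl] r r' rab; rewrite le_min => /andP[rd rd1].
    by apply/ltW/d1P => //; lra.
  exact: dP.
Qed.

(** The grid value 0 stands for the truncated region, where the approximant vanishes. *)
Definition conv_step (t : R) (y : X) : Y := if t == 0 then 0 else T t y.

Variables (s : R -> X) (a b d : R).
Hypotheses (ss : simple_function s) (a0 : 0 < a) (ab : a <= b) (d0 : 0 < d).

Definition conv_approx (x v : R) : Y := conv_step (trunc_grid a b d (v + x)) (s v).

Let sigma x v := (trunc_grid a b d (v + x), s v).

Let sigma_partition x : finite_partition_map (sigma x).
Proof.
apply: finite_partition_pair ss; exact: trunc_grid_shift_partition (ltW a0) d0.
Qed.

Lemma conv_approx_simple x : simple_function (conv_approx x).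
Proof. exact: (simple_function_comp (fun w => conv_step w.1 w.2) (sigma_partition x)). Qed.

Lemma conv_approx_support x v : conv_approx x v != 0 -> a <= v + x <= b.
Proof.
rewrite /conv_approx /conv_step; case: ifPn; first by rewrite eqxx.
by move=> /(trunc_grid_neq0 d0)[_ -> ->].
Qed.

Lemma conv_approx_support_finite x (D : set R) : measurable (D : set lebR) ->
  (leb (D `&` conv_approx x @^-1` [set~ 0%R] : set lebR) < +oo)%E.
Proof.
move=> mD; apply: (@le_lt_trans _ _ (leb (`[a - x, b - x]%classic : set lebR))); last first.
  by rewrite leb_itv ?lerD2r// ltry.
apply: le_measure; rewrite ?inE.
- by apply: measurableI mD _; exact: finite_partition_preimage (conv_approx_simple x).
- exact: measurable_itv_leb.
- move=> v [_ /= /eqP /conv_approx_support /andP[h1 h2]].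
  by rewrite in_itv/= lerBlDr lerBrDr h1.
Qed.

(** On the fixed finite index set B, only the measures of the pieces depend on x, and
   each piece with a nonzero grid value is A `&` ]t - d - x, t - x] for a measurable A. *)
Lemma conv_approx_lipschitz : exists C : R, forall x x',
  rnorm (simple_integral `]- x, +oo[ (conv_approx x) -
         simple_integral `]- x', +oo[ (conv_approx x')) <= C * `|x - x'|.
Proof.
pose B := range (trunc_grid a b d) `*` range s.
have fB : finite_set B by apply: finite_setX ss.1; exact: trunc_grid_finite (ltW a0) d0.
have sB x : range (sigma x) `<=` B.
  by move=> _ [v _ <-]; split => /=; [exists (v + x)|exists v].
have mD x : measurable (`]- x, +oo[%classic : set lebR) by exact: measurable_itv_leb.
pose c x w := fine (leb (`]- x, +oo[%classic `&` sigma x @^-1` [set w] : set lebR)).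
have IE x : simple_integral `]- x, +oo[ (conv_approx x) =
    \sum_(w \in B) (c x w)%:C *: conv_step w.1 w.2.
  apply: (simple_integral_comp (mD x) (sigma_partition x) fB (sB x)).
  exact: (conv_approx_support_finite x (mD x)).
have cL w x x' : w.1 != 0 -> `|c x w - c x' w| <= `|x - x'|.
  case: w => t y /= t0.
  have sE z : sigma z @^-1` [set (t, y)] =
      (fun v => v + z) @^-1` (trunc_grid a b d @^-1` [set t]) `&` s @^-1` [set y].
    by apply/seteqP; split => v /=; [case=> -> ->|case=> <- <-].
  have [E0|EI] := trunc_grid_fiber a b d0 t0.
    have c0 z : c z (t, y) = 0.
      by rewrite /c sE E0 preimage_set0 set0I setI0 measure0.
    by rewrite !c0 subrr normr0.
  have [g0|gpos] := pselect (range (trunc_grid a b d) t); last first.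
    have c0 z : c z (t, y) = 0.
      rewrite /c (_ : _ `&` _ = set0) ?measure0//.
      apply/seteqP; split => v //= [_ [vt _]]; apply: gpos.
      by exists (v + z).
    by rewrite !c0 subrr normr0.
  (* a nonzero grid value is at least a + d, so its fibre lies in the half-line *)
  have ta : a <= t - d.
    case: g0 => r _ rt; move: (rt); rewrite /trunc_grid; case: ifPn.
      by move=> /andP[h _] e; rewrite e in h; lra.
    by move=> _ e; rewrite -e eqxx in t0.
  have cE z : c z (t, y) = itv_trace (s @^-1` [set y]) (t - d) t z.
    rewrite /c /itv_trace sE EI; congr (fine (leb _)).
    apply/seteqP; split => v /=; rewrite !in_itv/= andbT.
      by move=> [_ [/andP[h1 h2] h3]]; split => //; apply/andP; split; lra.
    move=> [/andP[h1 h2] h3]; split; last by split; rewrite // -ltrBlDr -lerBrDr h1.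
    by rewrite (le_lt_trans _ h1)// lerBrDr addNr (le_trans (ltW a0)).
  by rewrite !cE; apply: itv_trace_lipschitz; [exact: ss.2|rewrite lerBlDr lerDl ltW].
exists (\sum_(w \in B) rnorm (conv_step w.1 w.2)) => x x'.
rewrite !IE !fsbig_finite// -sumrB mulr_suml.
apply: le_trans (rnorm_sum _ _ _) _; apply: ler_sum => w _.
rewrite -scalerBl -rmorphB rnormZ /conv_step; case: ifPn => [_|w0].
  by rewrite rnorm0 mulr0 mul0r.
by rewrite mulrC ler_wpM2l ?rnorm_ge0// cL.
Qed.

End ConvolutionApproximants.

Section ConvolutionBochner.
Context {R : realType} {X Y : normedModType R[i]}.
Notation lebR := (lebesgueR R).
Variable T : R -> {linear X -> Y}.
Hypothesis T_family : strongly_continuous_family T.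
Variables (f : R -> X) (s : nat -> R -> X) (d : nat -> R).
Hypothesis ss : forall m, simple_function (s m).
Hypothesis s_cvg : {ae leb, forall v : lebR, s m v @[m --> \oo] --> f v}.
Hypothesis s_dom : forall m v, rnorm (s m v) <= 2 * rnorm (f v).

Hypothesis d_gt0 : forall m, 0 < d m.
Hypothesis d_le : forall m, d m <= m.+1%:R^-1.
Hypothesis mesh : forall m v r r', m.+1%:R^-1 <= r <= m.+1%:R -> `|r - r'| <= d m ->
  rnorm (T r (s m v) - T r' (s m v)) <= m.+1%:R^-1 ^+ 2.

Variable x : R.
Hypothesis int_fin : (\int[leb]_(v in (`](- x)%R, +oo[%classic : set lebR))
  (opnorm (T (v + x)) * rnorm (f v))%:E < +oo)%E.

Let D : set R := `]- x, +oo[%classic.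
Let mD : measurable (D : set lebR). Proof. exact: measurable_itv_leb. Qed.
Let S (m : nat) := conv_approx T (s m) m.+1%:R^-1 m.+1%:R (d m) x.

Let tg m (v : R) := trunc_grid m.+1%:R^-1 m.+1%:R (d m) (v + x).
Let s' m (v : R) : X := if tg m v == 0 then 0 else s m v.

Let a0 m : 0 < m.+1%:R^-1 :> R. Proof. by rewrite invr_gt0. Qed.
Let ab m : m.+1%:R^-1 <= m.+1%:R :> R.
Proof. by rewrite (@le_trans _ _ 1)// ?invf_le1// ler1n. Qed.

Let D_gt0 v : D v -> 0 < v + x.
Proof. by rewrite /D /= in_itv/= andbT addrC -ltrBlDl sub0r. Qed.

Let s'_simple m : simple_function (s' m).
Proof.
exact: (simple_function_comp (fun w => if w.1 == 0 then 0 else w.2)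
  (finite_partition_pair (trunc_grid_shift_partition m.+1%:R x (ltW (a0 m)) (d_gt0 m)) (ss m))).
Qed.

(* s m is cut off where the grid value is 0; at a fixed v > -x the cut-off is
   inactive for large m *)
Let s'_cvg v : D v -> s m v @[m --> \oo] --> f v -> s' m v @[m --> \oo] --> f v.
Proof.
move=> Dv sv; suff near_s : {near \oo, (fun m => s m v) =1 (fun m => s' m v)}.
  by apply: cvg_trans sv; exact: near_eq_cvg.
have r0 := D_gt0 Dv; set r := v + x in r0.
have r2 : 0 < r / 2 by rewrite divr_gt0.
have r10 : 0 < r + 1 by lra.
have r1 : 0 < (r + 1)^-1 by rewrite invr_gt0.
near=> m; rewrite /s' /tg ifF//.
have m1 : m.+1%:R^-1 < r / 2 by near: m; exact: near_infty_natSinv_lt (PosNum r2).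
have m2 : r + 1 < m.+1%:R.
  rewrite -ltf_pV2 ?posrE//.
  by near: m; exact: near_infty_natSinv_lt (PosNum r1).
have dm := d_le m; have d0 := d_gt0 m.
have /andP[g1 g2] := grid_itv r d0; rewrite -/r.
have m3 : m.+1%:R^-1 <= 1 :> R by rewrite invf_le1// ler1n.
rewrite /trunc_grid ifT.
  by apply/negbTE; rewrite gt_eqF//; exact: lt_le_trans g2.
move: m1 m2 m3 dm g1 g2; rewrite -/r.
set gr := grid _ _; set iM := m.+1%:R^-1; set M := m.+1%:R => m1 m2 m3 dm g1 g2.
by apply/andP; split; lra.
Unshelve. all: by end_near.
Qed.

Let s'_dom m v : rnorm (f v - s' m v) <= 3 * rnorm (f v).
Proof.
have f0 := rnorm_ge0 (f v).
rewrite /s'; case: ifPn => _; first by rewrite subr0; lra.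
by have := rnorm_triangle (f v) (- s m v); have := s_dom m v; rewrite rnormN; lra.
Qed.

Let estimate m v : D v -> rnorm (T (v + x) (f v) - S m v) <=
  opnorm (T (v + x)) * rnorm (f v - s' m v) +
  m.+1%:R^-1 ^+ 2 * \1_(`[m.+1%:R^-1 - x, m.+1%:R - x]%classic : set R) v.
Proof.
move=> Dv; have r0 := D_gt0 Dv; have bT := T_family.1 _ r0.
rewrite /S /conv_approx /conv_step /s' -/(tg m v).
case: ifPn => [_|t0].
  by rewrite !subr0 (le_trans (rnorm_opnorm _ bT))// lerDl mulr_ge0// exprn_ge0.
have [tE ar rb] := trunc_grid_neq0 (d_gt0 m) t0.
rewrite indicE mem_set ?mulr1; last first.
  by rewrite /= in_itv/= lerBlDr lerBrDr ar.
rewrite (le_trans (rnorm_dist_le _ (T (v + x) (s m v)) _))// lerD//.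
  by rewrite -linearB rnorm_opnorm.
apply: mesh; first by rewrite ar.
have /andP[g1 g2] := grid_itv (v + x) (d_gt0 m).
by rewrite /tg tE distrC ger0_norm; lra.
Qed.

Let int_small m :
  (\int[leb]_(v in (D : set lebR))
    (m.+1%:R^-1 ^+ 2 * \1_(`[m.+1%:R^-1 - x, m.+1%:R - x]%classic : set R) v)%:E
   <= (m.+1%:R^-1)%:E)%E.
Proof.
pose J : set R := `[m.+1%:R^-1 - x, m.+1%:R - x]%classic; rewrite -/J.
have mI : measurable (J : set lebR) by exact: measurable_itv_leb.
under eq_integral do rewrite EFinM.
have i0 (v : R) : D v -> (0 <= (EFin \o (\1_J : R -> R)) v)%E.
  by move=> _; rewrite /= lee_fin.
have mi : measurable_fun (D : set lebR) (EFin \o (\1_J : R -> R)).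
  by apply/measurable_EFinP; exact: measurable_indic mI.
rewrite (ge0_integralZl_EFin leb mD i0 mi (exprn_ge0 2 (ltW (a0 m)))).
rewrite (integral_indic leb mD mI).
apply: (@le_trans _ _ ((m.+1%:R^-1 ^+ 2)%:E * (m.+1%:R)%:E)%E); last first.
  by rewrite -EFinM lee_fin expr2 -mulrA mulVf// mulr1.
apply: lee_wpmul2l; first by rewrite lee_fin exprn_ge0// ltW.
apply: (@le_trans _ _ (leb (J : set lebR))).
  by apply: measureIl.
rewrite /J leb_itv ?lerD2r// lee_fin opprB addrA subrK lerBlDr lerDl.
exact: ltW (a0 m).
Qed.

Let int_main : (\int[leb]_(v in (D : set lebR))
    (opnorm (T (v + x)) * rnorm (f v - s' m v))%:E)%E @[m --> \oo] --> 0%E.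
Proof.
have mop : measurable_fun (D : set lebR) (fun v => opnorm (T (v + x))).
  exact: opnorm_shift_measurable.
have lf : simple_limit_on D f.
  by exists s => //; apply: filterS s_cvg => v h _.
have mfs m : measurable_fun (D : set lebR) (fun v => rnorm (f v - s' m v)).
  apply/measurable_EFinP; apply: simple_limit_rnorm_measurable mD _.
  by apply: simple_limit_onB lf _; exact: simple_limit_simple.
have mf : measurable_fun (D : set lebR) (fun v => rnorm (f v)).
  by apply/measurable_EFinP; exact: simple_limit_rnorm_measurable mD lf.
have mprod m : measurable_fun (D : set lebR)
    (fun v => (opnorm (T (v + x)) * rnorm (f v - s' m v))%:E).
  by apply/measurable_EFinP; exact: measurable_funM mop (mfs m).
have mg1 : measurable_fun (D : set lebR) (fun v => (opnorm (T (v + x)) * rnorm (f v))%:E).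
  by apply/measurable_EFinP; exact: measurable_funM mop mf.
have op0 v : D v -> 0 <= opnorm (T (v + x)).
  by move=> /D_gt0 r0; apply: opnorm_ge0; exact: T_family.1.
pose g v : \bar R := (3%:E * (opnorm (T (v + x)) * rnorm (f v))%:E)%E.
have g10 v : D v -> (0 <= (opnorm (T (v + x)) * rnorm (f v))%:E)%E.
  by move=> Dv; rewrite lee_fin mulr_ge0 ?rnorm_ge0 ?op0.
have mg : measurable_fun (D : set lebR) g by exact: measurable_funeM mg1.
have ig : leb.-integrable (D : set lebR) g.
  apply/integrableP; split => //.
  rewrite (_ : (\int[leb]_(v in _) _)%E =
    (3%:E * \int[leb]_(v in (D : set lebR)) (opnorm (T (v + x)) * rnorm (f v))%:E)%E).
    by rewrite lte_mul_pinfty.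
  rewrite -(ge0_integralZl_EFin leb mD g10 mg1 (ler0n R 3)).
  apply: eq_integral => v; rewrite inE => Dv.
  by rewrite gee0_abs// /g mule_ge0// g10.
have cv : {ae leb, forall v : lebR, D v ->
    (opnorm (T (v + x)) * rnorm (f v - s' m v))%:E @[m --> \oo] --> 0%E}.
  apply: filterS s_cvg => v sv Dv.
  apply: cvg_EFin; first by near=> m.
  rewrite [X in _ --> X](_ : _ = opnorm (T (v + x)) * 0); last by rewrite mulr0.
  apply: cvgMr; apply: (cvg_trans _ ((cvg_rnorm_dist _ _).1 (s'_cvg Dv sv))).
  by apply: near_eq_cvg; near=> m; rewrite rnorm_distC.
have dom : {ae leb, forall (v : lebR) (m : nat), D v ->
    (`|(opnorm (T (v + x)) * rnorm (f v - s' m v))%:E| <= g v)%E}.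
  apply: aeW => v m Dv.
  have op := op0 _ Dv; rewrite /g -EFinM gee0_abs; last first.
    by rewrite lee_fin mulr_ge0 ?rnorm_ge0.
  by rewrite lee_fin mulrCA ler_wpM2l.
have [_ _] := dominated_convergence mD mprod (measurable_cst _) cv ig dom.
by rewrite integral0.
Unshelve. all: by end_near.
Qed.

(** The error is split as T(v+x) (f v - s' m v), handled by dominated convergence, plus
   the oscillation of T at mesh scale. The latter is at most 1/(m+1)^2 on an interval
   of length at most m+1. *)
Lemma conv_bochner_approx :
  bochner_approx `]- x, +oo[%classic (fun v => T (v + x) (f v)) S.
Proof.
have Ssimple m : simple_function (S m) :=
  conv_approx_simple T m.+1%:R (ss m) (a0 m) (d_gt0 m) x.
split => //.
- move=> m; apply/(finite_levelsP mD (Ssimple m)).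
  exact: (conv_approx_support_finite T (ss m) (a0 m) (ab m) (d_gt0 m) x mD).
- apply: filterS s_cvg => v sv Dv; apply/cvg_rnorm_dist.
  have r0 := D_gt0 Dv.
  pose u m := opnorm (T (v + x)) * rnorm (s' m v - f v) + m.+1%:R^-1.
  apply: (@squeeze_cvgr _ _ _ _ (fun=> 0) u); last 2 first.
  + exact: cvg_cst.
  + rewrite [X in _ --> X](_ : _ = opnorm (T (v + x)) * 0 + 0); last by rewrite mulr0 addr0.
    apply: cvgD; last exact: cvg_harmonic.
    by apply: cvgMr; exact: ((cvg_rnorm_dist _ _).1 (s'_cvg Dv sv)).
  near=> m; rewrite rnorm_ge0/= rnorm_distC (le_trans (estimate m Dv))//.
  rewrite /u (rnorm_distC (f v)) lerD2l indicE.
  have h1 : m.+1%:R^-1 <= 1 :> R by rewrite invf_le1// ler1n.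
  have h0 := ltW (a0 m).
  rewrite expr2; case: (_ \in _); rewrite ?mulr1 ?mulr0//.
  by rewrite ler_piMr.
- apply: (@squeeze_cvge _ _ _ _ (cst 0%E) _ (fun m => (\int[leb]_(v in (D : set lebR))
    (opnorm (T (v + x)) * rnorm (f v - s' m v))%:E + (m.+1%:R^-1)%:E)%E)).
  + near=> m; rewrite integral_ge0/=; last by move=> v _; rewrite lee_fin rnorm_ge0.
    apply: le_trans (leeD2l _ (int_small m)).
    have mop : measurable_fun (D : set lebR) (fun v => opnorm (T (v + x))).
      exact: opnorm_shift_measurable.
    apply: (le_integralD mD).
    * apply/measurable_EFinP; apply: measurable_funM mop _.
      apply/measurable_EFinP; apply: simple_limit_rnorm_measurable mD _.
      apply: simple_limit_onB; last exact: simple_limit_simple.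
      by exists s => //; apply: filterS s_cvg => v h _.
    * apply/measurable_EFinP; apply: measurable_funM; first exact: measurable_cst.
      by apply: measurable_indic; exact: measurable_itv_leb.
    * by move=> v _; rewrite lee_fin rnorm_ge0.
    * move=> v Dv; rewrite lee_fin mulr_ge0 ?rnorm_ge0 ?opnorm_ge0//.
      by apply: T_family.1; exact: D_gt0.
    * by move=> v _; rewrite lee_fin mulr_ge0// exprn_ge0// ltW.
    * by move=> v Dv; rewrite -EFinD lee_fin estimate.
  + exact: cvg_cst.
  + have c2 : (m.+1%:R^-1)%:E @[m --> \oo] --> (0 : R)%:E.
      by apply: cvg_EFin; [near=> m|exact: cvg_harmonic].
    have := cvgeD (_ : (0%E : \bar R) +? 0%:E)%E int_main c2.
    by rewrite adde0; apply.
Unshelve. all: by end_near.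
Qed.

End ConvolutionBochner.

(** The same sequence serves every x, and its integrals are Lipschitz in x; together
   these yield the existence of the convolution and the measurability of its
   differences. *)
Theorem convolution_approximants {R : realType} {X Y : normedModType R[i]}
    (T : R -> {linear X -> Y}) (f : R -> X) :
  strongly_continuous_family T -> strongly_measurable f ->
  exists S : nat -> R -> R -> Y,
    (forall x, (\int[leb]_(v in (`](- x)%R, +oo[%classic : set (lebesgueR R)))
        (opnorm (T (v + x)) * rnorm (f v))%:E < +oo)%E ->
      bochner_approx `]- x, +oo[%classic (fun v => T (v + x) (f v)) (fun m => S m x)) /\
    (forall m, exists C : R, forall x x',
      rnorm (simple_integral `]- x, +oo[ (S m x) -
             simple_integral `]- x', +oo[ (S m x')) <= C * `|x - x'|).
Proof.
move=> Tf /dominated_simple_sequence[s [ss scv sdom]].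
have a0 (m : nat) : 0 < m.+1%:R^-1 :> R by rewrite invr_gt0.
have ab (m : nat) : m.+1%:R^-1 <= m.+1%:R :> R.
  by rewrite (@le_trans _ _ 1)// ?invf_le1// ler1n.
have e0 (m : nat) : 0 < m.+1%:R^-1 ^+ 2 :> R by rewrite exprn_gt0.
have /choice[d dP] := fun m : nat => mesh_exists Tf m.+1%:R (ss m) (a0 m) (e0 m).
exists (fun m x => conv_approx T (s m) m.+1%:R^-1 m.+1%:R (d m) x); split => [x fin|m].
  apply: conv_bochner_approx => //.
  - by move=> m; have [] := dP m.
  - by move=> m; have [] := dP m.
  - by move=> m; have [] := dP m.
by apply: conv_approx_lipschitz => //; have [] := dP m.
Qed.

(** * Differences of the convolution *)

Section ConvolutionDifferences.
Context {R : realType} {X Y : completeNormedModType R[i]}.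
Notation lebR := (lebesgueR R).
Variables (T : R -> {linear X -> Y}) (g : R -> X).
Hypothesis T_family : strongly_continuous_family T.
Hypothesis g_meas : strongly_measurable (reflection g).
Hypothesis g_int : forall x, (\int[leb]_(v in (`](- x)%R, +oo[%classic : set lebR))
  (opnorm (T (v + x)) * rnorm (reflection g v))%:E < +oo)%E.

Let halfline (x : R) : set R := `]- x, +oo[%classic.
Let m_halfline x : measurable (halfline x : set lebR).
Proof. exact: measurable_itv_leb. Qed.
Let kernel x v : Y := T (v + x) (reflection g v).

(** The reflection v = -s passes from the half-line v > -x to the half-line s < x on
   which the convolution is defined. *)
Lemma convolution_of_approx x (S : nat -> R -> Y) :
  bochner_approx (halfline x) (kernel x) S ->
  bochner_integrable `]-oo, x[ (fun s => T (x - s) (g s)) /\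
  simple_integral (halfline x) (S m) @[m --> \oo] --> convolution T g x.
Proof.
move=> AS; have mp := measure_preserving_reflect (0 : R).
have [AS' SIE] := bochner_approx_transfer (m_halfline x) mp AS.
have kE : kernel x \o (fun v => 0 - v) = (fun s => T (x - s) (g s)).
  by apply/funext => s; rewrite /kernel /reflection /= sub0r opprK addrC.
have DE : (fun v => 0 - v) @^-1` halfline x = `]-oo, x[%classic.
  by apply/seteqP; split => v; rewrite /halfline /= !in_itv/= andbT sub0r ltrN2.
rewrite kE DE in AS' SIE; split; first by exists (fun m => S m \o (fun v => 0 - v)).
have := bochner_approx_cvg (measurable_itv_leb `]-oo, x[) AS'.
by under eq_fun do rewrite SIE.
Qed.

Lemma convolution_well_defined : convolution_integrable T g.
Proof.
have [S [AS _]] := convolution_approximants T_family g_meas.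
by move=> x; have [] := convolution_of_approx (AS x (g_int x)).
Qed.

Let difference tau v : X := reflection g (v - tau) - reflection g v.

(** The integral defining G(x + tau) is translated by tau, so that both integrals are
   over v > -x with the same operator T(v+x). *)
Lemma rnorm_convolution_diff_le x tau :
  ((rnorm (convolution T g (x + tau) - convolution T g x))%:E <=
   \int[leb]_(v in (halfline x : set lebR))
     (opnorm (T (v + x)) * rnorm (difference tau v))%:E)%E.
Proof.
have [S [AS _]] := convolution_approximants T_family g_meas.
have A1 := AS _ (g_int (x + tau)); have A2 := AS _ (g_int x).
have [_ L1] := convolution_of_approx A1; have [_ L2] := convolution_of_approx A2.
have [A1' SIE] := bochner_approx_transfer (m_halfline (x + tau))
  (measure_preserving_shift (- tau)) A1.
have DE : (fun v => v - tau) @^-1` halfline (x + tau) = halfline x.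
  apply/seteqP; split => v; rewrite /halfline /= !in_itv/= !andbT opprD.
    by rewrite ltrBrDr subrK.
  by rewrite ltrBrDr subrK.
rewrite DE in A1' SIE.
have L1' : simple_integral (halfline x) (S m (x + tau) \o (fun v => v - tau)) @[m --> \oo]
    --> convolution T g (x + tau).
  by rewrite (funext SIE).
apply: le_trans (bochner_integral_dist (m_halfline x) A1' A2 L1' L2) _.
apply: ge0_le_integral_nonmeas => v; rewrite /halfline /= in_itv/= andbT => xv.
have r0 : 0 < v + x by rewrite addrC -ltrBlDl sub0r.
rewrite lee_fin rnorm_ge0 lee_fin /=.
rewrite (_ : v - tau + (x + tau) = v + x); last by ring.
by rewrite -linearB rnorm_opnorm//; exact: T_family.1.
Qed.

Lemma reflection_measurable (D : set R) : measurable (D : set lebR) ->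
  measurable_fun (D : set lebR) (fun v => rnorm (reflection g v)).
Proof.
move=> mD; apply/measurable_EFinP; apply: simple_limit_rnorm_measurable mD _.
by have [s [ss cv]] := g_meas; exists s => //; apply: filterS cv => v h _.
Qed.

Lemma difference_measurable (D : set R) tau : measurable (D : set lebR) ->
  measurable_fun (D : set lebR) (fun v => rnorm (difference tau v)).
Proof.
move=> mD; apply/measurable_EFinP; apply: simple_limit_rnorm_measurable mD _.
have [s [ss cv]] := g_meas; have mp := measure_preserving_shift (- tau).
apply: simple_limit_onB; last by exists s => //; apply: filterS cv => v h _.
exists (fun m => s m \o (fun v => v - tau)).
  by move=> m; exact: finite_partition_preserving mp (ss m).
have := measure_preserving_ae (P := fun x => s x0 x @[x0 --> \oo] --> reflection g x) mp cv.
by apply: filterS => v h _.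
Qed.

Lemma kernel_bound_measurable x tau :
  measurable_fun (halfline x : set lebR)
    (fun v => opnorm (T (v + x)) * rnorm (difference tau v)).
Proof.
apply: measurable_funM; first exact: opnorm_shift_measurable.
exact: difference_measurable.
Qed.

(** The two terms of the triangle inequality are the integrability hypotheses at
   x + tau and at x. *)
Lemma kernel_bound_finite x tau :
  (\int[leb]_(v in (halfline x : set lebR))
     (opnorm (T (v + x)) * rnorm (difference tau v))%:E < +oo)%E.
Proof.
have mp := measure_preserving_shift (- tau).
have mop z : measurable_fun (halfline z : set lebR) (fun v => opnorm (T (v + z))).
  exact: opnorm_shift_measurable.
have op0 z v : halfline z v -> 0 <= opnorm (T (v + z)).
  rewrite /halfline /= in_itv/= andbT => zv; apply: opnorm_ge0; apply: T_family.1.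
  by rewrite addrC -ltrBlDl sub0r.
have mg z : measurable_fun (halfline z : set lebR)
    (fun v => (opnorm (T (v + z)) * rnorm (reflection g v))%:E).
  apply/measurable_EFinP; apply: measurable_funM (mop z) _.
  exact: reflection_measurable.
have g0 z v : halfline z v -> (0 <= (opnorm (T (v + z)) * rnorm (reflection g v))%:E)%E.
  by move=> zv; rewrite lee_fin mulr_ge0 ?rnorm_ge0 ?op0.
have DE : (fun v => v - tau) @^-1` halfline (x + tau) = halfline x.
  apply/seteqP; split => v; rewrite /halfline /= !in_itv/= !andbT opprD.
    by rewrite ltrBrDr subrK.
  by rewrite ltrBrDr subrK.
pose h v := (opnorm (T (v + x)) * rnorm (reflection g (v - tau)))%:E.
have hE v : h v = (opnorm (T (v - tau + (x + tau))) * rnorm (reflection g (v - tau)))%:E.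
  by rewrite /h (_ : v - tau + (x + tau) = v + x)//; ring.
have mh : measurable_fun (halfline x : set lebR) h.
  apply/measurable_EFinP; apply: measurable_funM (mop x) _.
  apply: (measurableT_comp (reflection_measurable measurableT)).
  exact: measurable_funTS (measure_preserving_measurable mp).
have Ih : (\int[leb]_(v in (halfline x : set lebR)) h v < +oo)%E.
  have := measure_preserving_integral mp (m_halfline (x + tau)) (mg (x + tau)) (g0 (x + tau)).
  rewrite DE (_ : (fun x0 => _) = h); last by apply/funext => v; rewrite hE.
  by move=> ->; exact: g_int.
apply: le_lt_trans (lte_add_pinfty Ih (g_int x)).
apply: (le_integralD (m_halfline x) mh (mg x)) => v xv.
- by rewrite lee_fin mulr_ge0 ?rnorm_ge0 ?op0.
- by rewrite lee_fin mulr_ge0 ?rnorm_ge0 ?op0.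
- exact: g0.
- rewrite -EFinD lee_fin -mulrDr ler_wpM2l ?op0// -(rnormN (reflection g v)).
  exact: rnorm_triangle.
Qed.

Lemma lipschitz_measurable (u : R -> R) (C : R) :
  (forall x x', `|u x - u x'| <= C * `|x - x'|) -> measurable_fun (setT : set lebR) u.
Proof.
move=> uL; apply: borel_measurable_fun_leb; apply: continuous_measurable_fun => x.
have C0 : 0 <= C by have := le_trans (normr_ge0 _) (uL 1 0); rewrite subr0 normr1 mulr1.
apply/cvgrPdist_lt => e e0.
have C1 : 0 < C + 1 by lra.
have eC : 0 < e / (C + 1) by rewrite divr_gt0.
near=> y; rewrite (le_lt_trans (uL _ _))//.
have xy : `|x - y| < e / (C + 1).
  by near: y; have := @cvg_id _ (nbhs x) => /cvgrPdist_lt; apply.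
rewrite (@le_lt_trans _ _ ((C + 1) * `|x - y|))//; first by rewrite ler_wpM2r//; lra.
by rewrite -ltr_pdivlMl// mulrC.
Unshelve. all: by end_near.
Qed.

(** A pointwise limit of Lipschitz functions. *)
Lemma convolution_diff_measurable tau :
  measurable_fun (setT : set lebR)
    (fun x => rnorm (convolution T g (x + tau) - convolution T g x)).
Proof.
have [S [AS SL]] := convolution_approximants T_family g_meas.
pose I m x := simple_integral (halfline x) (S m x).
apply: (@measurable_fun_cvg _ lebR R setT (fun m x => rnorm (I m (x + tau) - I m x))).
  move=> m; have [C CP] := SL m; apply: (@lipschitz_measurable _ (C + C)) => x x'.
  rewrite (le_trans (rnorm_dist _ _))//.
  rewrite (_ : _ - _ - _ = (I m (x + tau) - I m (x' + tau)) - (I m x - I m x')); last first.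
    by rewrite !opprB addrACA [RHS]addrACA (addrC (- I m x)).
  rewrite (le_trans (rnorm_triangle _ _))// rnormN mulrDl lerD ?CP//.
  by have := CP (x + tau) (x' + tau); rewrite (_ : x + tau - (x' + tau) = x - x')//; ring.
move=> x _; apply: cvg_rnorm; apply: cvgB.
  by have [] := convolution_of_approx (AS _ (g_int (x + tau))).
by have [] := convolution_of_approx (AS _ (g_int x)).
Qed.

End ConvolutionDifferences.

(** * Variable exponents: Young and Hoelder inequalities *)

Section VariableExponentSpaces.
Context {R : realType}.
Notation lebR := (lebesgueR R).
Implicit Types (D : set R) (p q : R -> \bar R) (u w : R -> R).

Lemma varphi_ge0 (r : \bar R) (t : R) : (0 <= varphi r t)%E.
Proof. by case: r => [r| |] //=; [rewrite lee_fin powR_ge0|case: ifP]. Qed.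

Lemma le_varphi (r : \bar R) (t t' : R) : (1 <= r)%E -> 0 <= t -> t <= t' ->
  (varphi r t <= varphi r t')%E.
Proof.
case: r => [r| |] //=.
  rewrite !lee_fin => r1 t0 tt'; apply: ge0_ler_powR => //; rewrite ?nnegrE//.
    exact: le_trans r1.
  exact: le_trans tt'.
move=> _ t0 tt'; case: (leP t' 1) => t1; last exact: leey.
by rewrite (le_trans tt' t1).
Qed.

(** For finite exponents this is Young's inequality without the factors 1/r and 1/r'.
   If one exponent is infinite the other is 1, and either the corresponding factor is
   at most 1 or the right-hand side is infinite. *)
Lemma varphi_young (r r' : \bar R) (x y : R) : (1 <= r)%E -> (1 <= r')%E ->
  (r^-1 + r'^-1 = 1)%E -> 0 <= x -> 0 <= y ->
  ((x * y)%:E <= varphi r x + varphi r' y)%E.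
Proof.
move=> r1 r'1 rr' x0 y0.
have oneoo (t : \bar R) : (1 <= t)%E -> (t^-1 + +oo^-1 = 1)%E -> t = 1%E.
  case: t => [t| |]//=; last by rewrite invey adde0 => _ /eqP; rewrite eqe eq_sym oner_eq0.
  rewrite lee_fin => t1; rewrite invey adde0 inver; case: ifPn => // t0 /eqP.
  by rewrite eqe => /eqP h; congr EFin; rewrite -[t]invrK h invr1.
case: r r1 rr' => [r| |] // r1; last first.
  rewrite addeC => /(oneoo _ r'1) ->; rewrite /= powRr1//.
  case: (leP x 1) => x1; last by rewrite addye// leey.
  by rewrite add0e lee_fin ler_piMl.
case: r' r'1 => [r'| |] // r'1; last first.
  move=> /(oneoo _ r1) ->; rewrite /= powRr1//.
  case: (leP y 1) => y1; last by rewrite addey// leey.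
  by rewrite adde0 lee_fin ler_piMr.
rewrite !lee_fin in r1 r'1.
have r0 : 0 < r by exact: lt_le_trans r1.
have r'0 : 0 < r' by exact: lt_le_trans r'1.
rewrite !inver !gt_eqF// => /eqP; rewrite -EFinD eqe => /eqP rr'.
rewrite /= -EFinD lee_fin (le_trans (conjugate_powR x0 y0 r0 r'0 rr'))// lerD//.
  by rewrite ler_pdivrMr// ler_peMr// powR_ge0.
by rewrite ler_pdivrMr// ler_peMr// powR_ge0.
Qed.

Lemma measurable_fun_powR2 D u w : measurable (D : set lebR) ->
  measurable_fun (D : set lebR) u -> measurable_fun (D : set lebR) w ->
  measurable_fun (D : set lebR) (fun x => u x `^ w x).
Proof.
move=> mD mu mw; rewrite /powR.
have m0 (h : R -> R) : measurable_fun (D : set lebR) h ->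
    measurable_fun (D : set lebR) (fun x => h x == 0).
  by move=> mh; exact: measurable_fun_eqr mh (measurable_cst _).
apply: (measurable_fun_if mD (m0 _ mu)).
  apply: (measurable_funS mD (@subIsetl _ D _)).
  rewrite (_ : (fun t => _) = (fun x => if w x == 0 then 1 else 0)); last first.
    by apply/funext => x; case: eqP.
  by apply: (measurable_fun_if mD (m0 _ mw)); exact: measurable_cst.
apply: (measurable_funS mD (@subIsetl _ D _)).
apply: (measurableT_comp (@measurable_expR R)); apply: (measurable_funM mw).
exact: (measurableT_comp (@measurable_ln R) mu).
Qed.

Lemma varphi_measurable D p u : exponent p -> measurable (D : set lebR) ->
  measurable_fun (D : set lebR) u ->
  measurable_fun (D : set lebR) (fun x => varphi (p x) (u x)).
Proof.
move=> [mp p1] mD mu.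
rewrite (_ : (fun x => _) = (fun x => if p x == +oo%E
    then (if u x <= 1 then 0%E else +oo%E) else (u x `^ fine (p x))%:E)); last first.
  by apply/funext => x; case: (p x) (p1 x).
have mpD : measurable_fun (D : set lebR) p by exact: measurable_funTS mp.
apply: (measurable_fun_if mD).
- apply: (measurable_fun_bool true).
  rewrite (_ : _ @^-1` _ = p @^-1` [set +oo%E]); first exact: mpD.
  by apply/seteqP; split => x /= /eqP.
- apply: (measurable_funS mD (@subIsetl _ D _)).
  apply: (measurable_fun_if mD); [|exact: measurable_cst..].
  exact: measurable_fun_ler mu (measurable_cst _).
- apply: (measurable_funS mD (@subIsetl _ D _)).
  apply/measurable_EFinP; apply: (measurable_fun_powR2 mD mu).
  exact: (measurableT_comp (fine_measurable measurableT) mpD).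
Qed.

(** The positive numbers over which the Luxemburg norm is an infimum. *)
Definition Lp_scale D p u (lam : R) := [/\ measurable_fun (D : set lebR) u,
  0 < lam & (modular D p (fun x => `|u x| / lam)%R <= 1)%E].

Lemma Lp_norm_lt D p u (c : R) : (Lp_norm D p u < c%:E)%E ->
  exists2 lam, lam < c & Lp_scale D p u lam.
Proof.
by move=> /ereal_inf_lt [_ [lam h <-]]; rewrite lte_fin => lc; exists lam.
Qed.

Lemma Lp_norm_ge0 D p u : (0 <= Lp_norm D p u)%E.
Proof.
by apply: le_ereal_inf_tmp => _ [lam [_ /ltW l0 _] <-]; rewrite lee_fin.
Qed.

Lemma Lp_norm_le D p u lam : Lp_scale D p u lam -> (Lp_norm D p u <= lam%:E)%E.
Proof. by move=> h; apply: ereal_inf_lbound; exists lam. Qed.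

(** Integrate Young's inequality for |u| / lam and |w| / mu: the two modulars are at
   most 1 each, hence the constant 2. *)
Lemma hoelder_scale D p q u w lam mu : exponent p -> exponent q ->
  (forall x, ((p x)^-1 + (q x)^-1 = 1)%E) -> measurable (D : set lebR) ->
  Lp_scale D p u lam -> Lp_scale D q w mu ->
  (\int[leb]_(x in (D : set lebR)) (`|u x| * `|w x|)%:E <= (2 * lam * mu)%:E)%E.
Proof.
move=> ep eq pq mD [mu_ lam0 hu] [mw mu0 hw].
have mnu : measurable_fun (D : set lebR) (fun x => `|u x| / lam).
  apply: measurable_funM; last exact: measurable_cst.
  exact: measurableT_comp.
have mnw : measurable_fun (D : set lebR) (fun x => `|w x| / mu).
  apply: measurable_funM; last exact: measurable_cst.
  exact: measurableT_comp.
have nu0 x : 0 <= `|u x| / lam by rewrite divr_ge0// ltW.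
have nw0 x : 0 <= `|w x| / mu by rewrite divr_ge0// ltW.
have h2 : (\int[leb]_(x in (D : set lebR)) ((`|u x| / lam) * (`|w x| / mu))%:E <= 2%:E)%E.
  apply: (@le_trans _ _ (modular D p (fun x => `|u x| / lam)%R +
      modular D q (fun x => `|w x| / mu)%R)%E).
    apply: (le_integralD mD (varphi_measurable ep mD mnu) (varphi_measurable eq mD mnw)).
    - by move=> x _; rewrite lee_fin mulr_ge0.
    - by move=> x _; exact: varphi_ge0.
    - by move=> x _; exact: varphi_ge0.
    - by move=> x _; apply: varphi_young => //; [exact: ep.2|exact: eq.2].
  by rewrite (le_trans (leeD hu hw))// -EFinD lee_fin.
have mprod : measurable_fun (D : set lebR)
    (fun x => ((`|u x| / lam) * (`|w x| / mu))%:E).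
  by apply/measurable_EFinP; exact: measurable_funM.
have prod0 x : D x -> (0 <= ((`|u x| / lam) * (`|w x| / mu))%:E)%E.
  by move=> _; rewrite lee_fin mulr_ge0.
have lm0 : 0 <= lam * mu by rewrite mulr_ge0// ltW.
rewrite (_ : (\int[leb]_(x in _) _)%E = ((lam * mu)%:E *
    \int[leb]_(x in (D : set lebR)) ((`|u x| / lam) * (`|w x| / mu))%:E)%E); last first.
  rewrite -(ge0_integralZl_EFin leb mD prod0 mprod lm0).
  apply: eq_integral => x _; rewrite -EFinM; congr EFin; field.
  by rewrite !gt_eqF.
apply: (@le_trans _ _ ((lam * mu)%:E * 2%:E)%E); last by rewrite -EFinM lee_fin; lra.
by apply: lee_wpmul2l => //; rewrite lee_fin.
Qed.

(** This passes to the infimum in [hoelder_scale] when the infima N and P may be 0 and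
   need not be attained. *)
Lemma le_mul_inf (I : \bar R) (N P : R) : 0 <= N -> 0 <= P ->
  (forall lam mu, N < lam -> P < mu -> (I <= (2 * lam * mu)%:E)%E) ->
  (I <= (2 * N * P)%:E)%E.
Proof.
move=> N0 P0 h; apply/lee_addgt0Pr => e e0.
pose c := 2 * (N + P + 1).
have c0 : 0 < c by rewrite /c; lra.
pose d := Num.min 1 (e / c).
have d0 : 0 < d by rewrite lt_min ltr01 divr_gt0.
have d1 : d <= 1 by rewrite ge_min lexx.
have de : d * c <= e by rewrite -ler_pdivlMr// ge_min lexx orbT.
apply: le_trans (h (N + d) (P + d) _ _) _; rewrite ?ltrDl//.
rewrite -EFinD lee_fin.
rewrite (_ : 2 * (N + d) * (P + d) = 2 * N * P + (2 * (N + P) * d + 2 * d * d)); last by ring.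
rewrite lerD2l (le_trans _ de)// /c.
have : d * d <= d by rewrite ler_piMr// ltW.
lra.
Qed.

Lemma hoelder_variable D p q u w : exponent p -> exponent q ->
  (forall x, ((p x)^-1 + (q x)^-1 = 1)%E) -> measurable (D : set lebR) ->
  (Lp_norm D p u < +oo)%E -> (Lp_norm D q w < +oo)%E ->
  (\int[leb]_(x in (D : set lebR)) (`|u x| * `|w x|)%:E <=
   2%:E * Lp_norm D p u * Lp_norm D q w)%E.
Proof.
move=> ep eq pq mD.
have := Lp_norm_ge0 D p u; have := Lp_norm_ge0 D q w.
case Eu : (Lp_norm D p u) => [N| |]//; case Ew : (Lp_norm D q w) => [P| |]//.
rewrite !lee_fin => P0 N0 _ _; rewrite -!EFinM; apply: le_mul_inf => // lam mu Nl Pm.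
have [lam' l1 Sl] : exists2 lam', lam' < lam & Lp_scale D p u lam'.
  by apply: Lp_norm_lt; rewrite Eu lte_fin.
have [mu' m1 Sm] : exists2 mu', mu' < mu & Lp_scale D q w mu'.
  by apply: Lp_norm_lt; rewrite Ew lte_fin.
apply: le_trans (hoelder_scale ep eq pq mD Sl Sm) _.
have [_ l0 _] := Sl; have [_ m0 _] := Sm.
rewrite lee_fin ler_pM// ?mulr_ge0 ?ltW//.
by rewrite ltr_pM2l.
Qed.

Lemma Lp_norm_measurable D p u : (Lp_norm D p u < +oo)%E ->
  measurable_fun (D : set lebR) u.
Proof. by move=> /ereal_inf_lt [_ [lam [h _ _] _] _]. Qed.

End VariableExponentSpaces.

(** * Jensen's inequality on a weighted partition of a half-line *)

Section Jensen.
Context {R : realType}.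
Notation lebR := (lebesgueR R).
Variable phi : R -> R.
Hypothesis phi_ge0 : forall x : R, 0 <= x -> 0 <= phi x.
Hypothesis phi_convex : convex_function (`[0, +oo[ : set R^o) phi.
Hypothesis phi_mono : forall x y : R, 0 <= x -> x <= y -> phi x <= phi y.

Lemma convex_slopes (s m t : R) : 0 <= s -> s < m -> m < t ->
  (phi m - phi s) / (m - s) <= (phi t - phi m) / (t - m).
Proof.
move=> s0 sm mt.
have ms0 : 0 < m - s by rewrite subr_gt0.
have tm0 : 0 < t - m by rewrite subr_gt0.
have ts0 : 0 < t - s by lra.
(* the weight that expresses m as a convex combination of t and s *)
pose c := (m - s) / (t - s).
have c0 : 0 <= c by rewrite divr_ge0// ltW.
have c1 : c <= 1 by rewrite ler_pdivrMr// mul1r; lra.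
have tD : t \in (`[0, +oo[%classic : set R^o) by rewrite inE /= in_itv/= andbT; lra.
have sD : s \in (`[0, +oo[%classic : set R^o) by rewrite inE /= in_itv/= andbT.
have h : phi (c * t + (1 - c) * s) <= c * phi t + (1 - c) * phi s.
  exact: (phi_convex (Itv01 c0 c1) tD sD).
have mE : c * t + (1 - c) * s = m.
  by rewrite /c; field; rewrite gt_eqF.
rewrite mE in h.
rewrite ler_pdivrMr// mulrAC ler_pdivlMr//.
have h' : phi m * (t - s) <= (m - s) * phi t + (t - m) * phi s.
  rewrite -ler_pdivlMr//; apply: le_trans h _.
  rewrite le_eqVlt; apply/orP; left; apply/eqP.
  by rewrite /c; field; rewrite gt_eqF.
lra.
Qed.

(** The slope is the supremum of the slopes of the chords ending at m; it is
   nonnegative since phi is monotone. The products c * t and c * m are kept on opposite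
   sides so that only nonnegative quantities are integrated. *)
Lemma supporting_line (m : R) : 0 <= m ->
  exists2 c, 0 <= c & forall t, 0 <= t -> phi m + c * t <= phi t + c * m.
Proof.
rewrite le_eqVlt => /predU1P[<-|m0].
  by exists 0 => // t t0; rewrite !mul0r !addr0 phi_mono.
pose A := [set (phi m - phi s) / (m - s) | s in [set s | 0 <= s < m]].
have A0 : A ((phi m - phi 0) / (m - 0)) by exists 0; rewrite /= ?lexx.
have ubA t : m < t -> ubound A ((phi t - phi m) / (t - m)).
  by move=> mt _ [s /= /andP[s0 sm] <-]; exact: convex_slopes.
have supA : has_sup A.
  split; first by exists ((phi m - phi 0) / (m - 0)).
  by exists ((phi (m + 1) - phi m) / (m + 1 - m)); apply: ubA; rewrite ltrDl.
exists (sup A) => [|t t0].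
  have /(_ _ A0) := sup_upper_bound supA; apply: le_trans.
  by rewrite subr0 divr_ge0 ?subr_ge0 ?phi_mono// ltW.
have [tm|mt|<-//] := ltgtP t m.
  have tm0 : 0 < m - t by rewrite subr_gt0.
  have : (phi m - phi t) / (m - t) <= sup A.
    by apply: sup_upper_bound => //; exists t; rewrite //= t0.
  by rewrite ler_pdivrMr//; lra.
have tm0 : 0 < t - m by rewrite subr_gt0.
have : sup A <= (phi t - phi m) / (t - m) by apply: ge_sup (ubA _ mt); exists ((phi m - phi 0) / (m - 0)).
by rewrite ler_pdivlMr//; lra.
Qed.

(** phi is monotone on [0, +oo[ only; t |-> phi (max t 0) is monotone on the line. *)
Lemma monotone_comp_measurable (D : set R) (u : R -> R) : measurable (D : set lebR) ->
  measurable_fun (D : set lebR) u -> (forall x, D x -> 0 <= u x) ->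
  measurable_fun (D : set lebR) (fun x => phi (u x)).
Proof.
move=> mD mu u0.
apply: (@eq_measurable_fun _ _ lebR _ D ((fun t => phi (Num.max t 0)) \o u)).
  by move=> x; rewrite inE => /u0 ux; rewrite /= max_l.
apply: (measurableT_comp _ mu); apply: nondecreasing_measurable; first exact: measurableT.
move=> s t st; apply: phi_mono; first by rewrite le_max lexx orbT.
by rewrite ge_max !le_max st lexx !orbT.
Qed.

(** Jensen's inequality for the measure of density a_k / l on the k-th cell, which has
   mass 1. The supporting line of phi at the mean M is integrated over each cell, and
   the sums of a_k c M and of c times the cell integrals of w cancel. *)
Lemma jensen_series (x l : R) (a : nat -> R) (w : R -> R) : 0 < l ->
  (forall k, 0 < a k) -> (\sum_(0 <= k <oo) (a k)%:E = 1)%E ->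
  measurable_fun (`]- x, +oo[%classic : set lebR) w ->
  (forall v, - x < v -> 0 <= w v) ->
  (\int[leb]_(v in (`](- x)%R, +oo[%classic : set lebR)) (w v)%:E < +oo)%E ->
  ((phi (fine (\int[leb]_(v in (`](- x)%R, +oo[%classic : set lebR)) (w v)%:E)))%:E <=
   \sum_(0 <= k <oo) ((a k / l)%:E *
     \int[leb]_(v in (`](- x + k%:R * l)%R, (- x + k.+1%:R * l)%R]%classic : set lebR))
       (phi (l / a k * w v))%:E))%E.
Proof.
move=> l0 a0 a1 mw w0 wfin.
set M := fine _.
pose I k : set R := `](- x + k%:R * l)%R, (- x + k.+1%:R * l)%R]%classic.
have mI k : measurable (I k : set lebR) by exact: measurable_itv_leb.
have IU : \bigcup_k I k = `]- x, +oo[%classic.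
  apply/seteqP; split => [v [k _]|v]; rewrite /I /= !in_itv/= ?andbT.
    move=> /andP[h _]; apply: le_lt_trans h.
    by rewrite lerDl mulr_ge0// ltW.
  move=> xv; have r0 : 0 < (v + x) / l by rewrite divr_gt0//; lra.
  have c0 : 0 < Num.ceil ((v + x) / l) by rewrite ceil_gt0.
  have /andP[h1 h2] := ceil_itv ((v + x) / l).
  (* the cells are open on the left, so the index is the ceiling minus one *)
  exists (`|Num.ceil ((v + x) / l)|%N.-1) => //.
  have nE : (`|Num.ceil ((v + x) / l)|%N.-1.+1%:R : R) = (Num.ceil ((v + x) / l))%:~R.
    by rewrite prednK ?absz_gt0 ?gt_eqF// natr_absz gtr0_norm.
  have nE' : (`|Num.ceil ((v + x) / l)|%N.-1%:R : R) = (Num.ceil ((v + x) / l) - 1)%:~R.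
    by rewrite rmorphB/= -nE -natr1 addrK.
  rewrite /I /= in_itv/= nE nE'.
  move: h1 h2; rewrite ltr_pdivlMr// ler_pdivrMr// => h1 h2.
  by apply/andP; split; lra.
have Isub k : I k `<=` `]- x, +oo[%classic by rewrite -IU; exact: bigcup_sup.
have Ipos k v : I k v -> 0 <= w v.
  by move=> /Isub; rewrite /= in_itv/= andbT; exact: w0.
have tI : trivIset setT I.
  apply: ltn_trivIset => m n nm; apply/seteqP; split => // v [].
  rewrite /I /= !in_itv/= => /andP[_ h2] /andP[h1 _].
  have : n.+1%:R * l <= m%:R * l by rewrite ler_pM2r// ler_nat.
  move: h1 h2; set p := m%:R * l; set p' := n.+1%:R * l; lra.
have w0E v : (`]- x, +oo[%classic : set R) v -> (0 <= (w v)%:E)%E.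
  by rewrite /= in_itv/= andbT lee_fin; exact: w0.
have mwE : measurable_fun (`]- x, +oo[%classic : set lebR) (fun v => (w v)%:E).
  exact/measurable_EFinP.
have sumI : (\int[leb]_(v in (`](- x)%R, +oo[%classic : set lebR)) (w v)%:E =
    \sum_(0 <= k <oo) \int[leb]_(v in (I k : set lebR)) (w v)%:E)%E.
  have mwU : measurable_fun (\bigcup_k I k : set lebR) (fun v => (w v)%:E) by rewrite IU.
  have w0U v : (\bigcup_k I k) v -> (0 <= (w v)%:E)%E by rewrite IU; exact: w0E.
  by rewrite -IU (ge0_integral_bigcup leb mI mwU w0U tI).
have M0 : 0 <= M by apply: fine_ge0; apply: integral_ge0 => v /w0E.
have ME : (\int[leb]_(v in (`](- x)%R, +oo[%classic : set lebR)) (w v)%:E = M%:E)%E.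
  by rewrite /M fineK// ge0_fin_numE//; apply: integral_ge0 => v /w0E.
have [c c0 cP] := supporting_line M0.
pose A k := (\int[leb]_(v in (I k : set lebR)) (w v)%:E)%E.
pose B k := (\int[leb]_(v in (I k : set lebR)) (phi (l / a k * w v))%:E)%E.
have A0 k : (0 <= A k)%E by apply: integral_ge0 => v Iv; rewrite lee_fin; exact: (Ipos _ _ Iv).
have wk0 k v : I k v -> 0 <= l / a k * w v.
  by move=> Iv; rewrite mulr_ge0 ?(Ipos Iv)// ?(Ipos _ _ Iv)// divr_ge0// ltW.
have B0 k : (0 <= B k)%E.
  by apply: integral_ge0 => v Iv; rewrite lee_fin phi_ge0// (wk0 _ _ Iv).
have mwk k : measurable_fun (I k : set lebR) (fun v => (w v)%:E).
  exact: measurable_funS (measurable_itv_leb _) (Isub k) mwE.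
have mwlk k : measurable_fun (I k : set lebR) (fun v => l / a k * w v).
  by apply: measurable_funM; [exact: measurable_cst|exact/measurable_EFinP].
have mB k : measurable_fun (I k : set lebR) (fun v => (phi (l / a k * w v))%:E).
  by apply/measurable_EFinP; apply: monotone_comp_measurable (mI k) (mwlk k) _; exact: wk0.
have lI k : leb (I k : set lebR) = l%:E.
  rewrite /I leb_itv; last by rewrite lerD2l ler_pM2r// ler_nat.
  by congr EFin; rewrite -natr1; ring.
have cstI k (r : R) : (\int[leb]_(v in (I k : set lebR)) r%:E = (r * l)%:E)%E.
  apply: etrans (integral_cst leb (mI k) r%:E) _.
  by rewrite EFinM; congr (_ * _)%E; exact: lI.
have step k : ((a k * phi M)%:E + c%:E * A k <= (a k / l)%:E * B k + (a k * (c * M))%:E)%E.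
  have ak := a0 k.
  have cla0 : 0 <= c * (l / a k) by rewrite mulr_ge0// divr_ge0// ltW.
  have h1 : (\int[leb]_(v in (I k : set lebR)) ((phi M)%:E + (c * (l / a k))%:E * (w v)%:E) <=
             \int[leb]_(v in (I k : set lebR)) ((phi (l / a k * w v))%:E + (c * M)%:E))%E.
    apply: ge0_le_integral_nonmeas => v Iv.
    rewrite -EFinM -!EFinD !lee_fin; apply/andP; split.
      by rewrite addr_ge0 ?phi_ge0// mulr_ge0// (Ipos _ _ Iv).
    by rewrite -(mulrA c); apply: cP; exact: wk0 Iv.
  have k1 v : I k v -> (0 <= (c * (l / a k))%:E * (w v)%:E)%E.
    by move=> Iv; rewrite -EFinM lee_fin mulr_ge0// (Ipos _ _ Iv).
  have k2 v : I k v -> (0 <= (w v)%:E)%E by move=> Iv; rewrite lee_fin (Ipos _ _ Iv).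
  have k3 v : I k v -> (0 <= (phi (l / a k * w v))%:E)%E.
    by move=> Iv; rewrite lee_fin phi_ge0// (wk0 _ _ Iv).
  have k4 v : I k v -> (0 <= (phi M)%:E)%E by move=> _; rewrite lee_fin phi_ge0.
  have k5 v : I k v -> (0 <= (c * M)%:E)%E by move=> _; rewrite lee_fin mulr_ge0.
  rewrite (ge0_integralD leb (mI k) k4 (measurable_cst _) k1 (measurable_funeM _ (mwk k))) in h1.
  rewrite (ge0_integralD leb (mI k) k3 (mB k) k5 (measurable_cst _)) in h1.
  rewrite (ge0_integralZl_EFin leb (mI k) k2 (mwk k) cla0) !cstI -/(A k) -/(B k) in h1.
  have al0 : (0 <= (a k / l)%:E)%E by rewrite lee_fin divr_ge0// ltW.
  have := lee_wpmul2l al0 h1.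
  have p1 : (0 <= (phi M * l)%:E)%E by rewrite lee_fin mulr_ge0 ?phi_ge0// ltW.
  have p2 : (0 <= (c * (l / a k))%:E * A k)%E by rewrite mule_ge0.
  have p3 : (0 <= (c * M * l)%:E)%E by rewrite lee_fin !mulr_ge0// ltW.
  rewrite (ge0_muleDr _ p1 p2) (ge0_muleDr _ (B0 k) p3).
  rewrite muleA -!EFinM.
  rewrite (_ : a k / l * (phi M * l) = a k * phi M); last by field; rewrite gt_eqF.
  rewrite (_ : a k / l * (c * (l / a k)) = c); last by field; rewrite !gt_eqF.
  by rewrite (_ : a k / l * (c * M * l) = a k * (c * M)); last by field; rewrite gt_eqF.
have sumA : (\sum_(0 <= k <oo) A k = M%:E)%E by rewrite -sumI ME.
have cst_sum (r : R) : 0 <= r -> (\sum_(0 <= k <oo) (a k * r)%:E = r%:E)%E.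
  move=> r0; under eq_eseriesr do rewrite mulrC EFinM.
  rewrite nneseriesZl; first by rewrite a1 mule1.
  by move=> k _; rewrite lee_fin ltW.
have big : (\sum_(0 <= k <oo) ((a k * phi M)%:E + c%:E * A k) <=
    \sum_(0 <= k <oo) ((a k / l)%:E * B k + (a k * (c * M))%:E))%E.
  apply: lee_nneseries => k _; last exact: step.
  by move=> _; rewrite adde_ge0 ?mule_ge0 ?lee_fin ?mulr_ge0 ?phi_ge0// ltW.
rewrite nneseriesD in big; first last.
- by move=> k _ _; rewrite mule_ge0// lee_fin.
- by move=> k _ _; rewrite lee_fin mulr_ge0 ?phi_ge0// ltW.
rewrite nneseriesD in big; first last.
- by move=> k _ _; rewrite lee_fin !mulr_ge0// ltW.
- by move=> k _ _; rewrite mule_ge0// lee_fin divr_ge0// ltW.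
rewrite nneseriesZl in big; last by move=> k _; exact: A0.
rewrite sumA !cst_sum ?phi_ge0 ?mulr_ge0// in big.
by rewrite -EFinM leeD2rE in big.
Qed.

End Jensen.

(** * Almost periods of the convolution *)

Lemma le_nneseries_term {R : realType} (u : nat -> \bar R) k :
  (forall n, (0 <= u n)%E) -> (u k <= \sum_(0 <= n <oo) u n)%E.
Proof.
move=> u0; apply: le_trans (nneseries_lim_ge k.+1 _); last by move=> n _ _; exact: u0.
by rewrite big_nat_recr//= leeDr// sume_ge0.
Qed.

Section ConvolutionWeyl.
Context {R : realType} {X Y : completeNormedModType R[i]}.
Notation lebR := (lebesgueR R).
Variables (phi vphi : R -> R) (F F1 : R -> R -> R) (p q : R -> \bar R).
Variables (T : R -> {linear X -> Y}) (a : nat -> R) (g : R -> X).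
Hypothesis phi_ge0 : forall x : R, 0 <= x -> 0 <= phi x.
Hypothesis vphi_ge0 : forall x : R, 0 <= x -> 0 <= vphi x.
Hypothesis phi_convex : convex_function (`[0, +oo[ : set R^o) phi.
Hypothesis phi_mono : forall x y : R, 0 <= x -> x <= y -> phi x <= phi y.
Hypothesis phi_vphi : forall x y : R, 0 <= x -> 0 <= y -> phi (x * y) <= vphi x * phi y.
Hypothesis F_gt0 : forall l t : R, 0 < l -> 0 < F l t.
Hypothesis F1_gt0 : forall l t : R, 0 < l -> 0 < F1 l t.
Hypotheses (p_exp : exponent p) (q_exp : exponent q).
Hypothesis pq_conj : forall x, ((p x)^-1 + (q x)^-1 = 1)%E.
Hypothesis T_family : strongly_continuous_family T.
Hypothesis a_gt0 : forall k, 0 < a k.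
Hypothesis a_sum : (\sum_(0 <= k <oo) (a k)%:E = 1)%E.
Hypothesis g_meas : strongly_measurable (reflection g).
Hypothesis g_int : forall x, (\int[leb]_(v in `](- x)%R, +oo[)
  (opnorm (T (v + x)) * rnorm (reflection g v))%:E < +oo)%E.
Hypothesis H_fin : forall x l : R, 0 < l -> (Hsum T vphi F q a l x < +oo)%E.

Let w (x tau v : R) : R :=
  opnorm (T (v + x)) * rnorm (reflection g (v - tau) - reflection g v).
Let cell (x l : R) (k : nat) : set R := `[(- x + k%:R * l), (- x + k.+1%:R * l)]%classic.
Let qnorm (x l : R) (k : nat) : \bar R :=
  Lp_norm (cell x l k) q (fun v => vphi (opnorm (T (v + x)))).
Let term (x l : R) (k : nat) : \bar R :=
  ((a k * vphi (l * (a k)^-1))%:E * qnorm x l k * ((F l (- x + l * k%:R))^-1)%:E)%E.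

Let opnorm_pos x v : - x < v -> 0 <= opnorm (T (v + x)).
Proof.
move=> xv; apply: opnorm_ge0; apply: T_family.1.
by rewrite addrC -ltrBlDl sub0r.
Qed.

Let term_ge0 x l k : 0 < l -> (0 <= term x l k)%E.
Proof.
move=> l0; apply: mule_ge0; last by rewrite lee_fin invr_ge0 ltW// F_gt0.
apply: mule_ge0; last exact: Lp_norm_ge0.
by rewrite lee_fin mulr_ge0 ?vphi_ge0 ?divr_ge0// ltW.
Qed.

(** If vphi (l / a k) = 0, then phi vanishes on [0, +oo[ and so does the left-hand side.
   Otherwise the finiteness of H makes the Luxemburg norm of vphi(|T|) finite, in
   particular vphi(|T|) is measurable, and Hoelder's inequality applies. *)
Lemma cell_estimate (x tau l eps : R) k : 0 < l -> 0 < eps ->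
  (weyl_sup p phi F (reflection g) (- tau) l <= eps%:E)%E ->
  ((a k / l)%:E *
     \int[leb]_(v in (`](- x + k%:R * l)%R, (- x + k.+1%:R * l)%R]%classic : set lebR))
       (phi (l / a k * w x tau v))%:E <=
   (2 / l * eps)%:E * term x l k)%E.
Proof.
move=> l0 eps0 wsup; have ak := a_gt0 k.
pose J : set R := `](- x + k%:R * l)%R, (- x + k.+1%:R * l)%R]%classic; rewrite -/J.
have mJ : measurable (J : set lebR) by exact: measurable_itv_leb.
have mC : measurable (cell x l k : set lebR) by exact: measurable_itv_leb.
have JC : J `<=` cell x l k.
  by move=> v; rewrite /J /cell /= !in_itv/= => /andP[/ltW -> ->].
have Jx v : J v -> - x < v.
  rewrite /J /= in_itv/= => /andP[h _]; apply: le_lt_trans h.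
  by rewrite lerDl mulr_ge0// ltW.
have w0 v : J v -> 0 <= w x tau v.
  by move=> /Jx xv; rewrite mulr_ge0 ?rnorm_ge0 ?opnorm_pos.
have la0 : 0 <= l / a k by rewrite divr_ge0// ltW.
have phiw v : J v -> phi (l / a k * w x tau v) <= vphi (l / a k) *
    (phi (rnorm (reflection g (v - tau) - reflection g v)) * vphi (opnorm (T (v + x)))).
  move=> Jv; have o0 := opnorm_pos (Jx _ Jv).
  rewrite (le_trans (phi_vphi la0 (w0 _ Jv)))// ler_wpM2l ?vphi_ge0//.
  by rewrite [leRHS]mulrC phi_vphi ?rnorm_ge0.
have v0 : 0 <= vphi (l / a k) by exact: vphi_ge0.
have [vE|vne] := eqVneq (vphi (l / a k)) 0.
  rewrite (_ : (\int[leb]_(v in _) _)%E = 0%E).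
    rewrite mule0 mule_ge0 ?term_ge0// lee_fin mulr_ge0 ?divr_ge0// ltW//.
  apply: integral0_eq => v Jv; congr EFin; apply/eqP; rewrite eq_le phi_ge0 ?andbT.
    by rewrite (le_trans (phiw _ Jv))// vE mul0r.
  by rewrite mulr_ge0// w0.
have vpos : 0 < vphi (l / a k) by rewrite lt_neqAle eq_sym vne.
have Fpos : 0 < F l (- x + l * k%:R) by exact: F_gt0.
set Fk := F l (- x + l * k%:R) in Fpos.
have qfin : (qnorm x l k < +oo)%E.
  rewrite ltey; apply/eqP => qE.
  have : (term x l k < +oo)%E.
    apply: le_lt_trans (H_fin x l0).
    exact: (le_nneseries_term k (fun n => term_ge0 x n l0)).
  rewrite /term qE gt0_muley ?lte_fin ?mulr_gt0//.
  by rewrite gt0_mulye ?lte_fin ?invr_gt0// ltxx.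
pose u := phi_diff phi (reflection g) (- tau).
pose P := Lp_norm (cell x l k) p u.
have cE : cell x l k = `[(- x + l * k%:R), (- x + l * k%:R + l)]%classic.
  by rewrite /cell -addrA -natr1 mulrDl mul1r (mulrC l).
have PF : (P <= (eps / Fk)%:E)%E.
  have : (Fk%:E * P <= eps%:E)%E.
    apply: le_trans wsup; apply: ereal_sup_ubound.
    by exists (- x + l * k%:R); [exact: Logic.I|rewrite /P cE].
  by rewrite -lee_pdivlMl// -EFinM mulrC.
have Pfin : (P < +oo)%E by apply: le_lt_trans PF _; exact: ltry.
have mu : measurable_fun (cell x l k : set lebR) u by exact: Lp_norm_measurable Pfin.
pose z v := vphi (opnorm (T (v + x))).
have mz : measurable_fun (cell x l k : set lebR) z by exact: Lp_norm_measurable qfin.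
have muz : measurable_fun (cell x l k : set lebR) (fun v => (`|u v| * `|z v|)%:E).
  by apply/measurable_EFinP; apply: measurable_funM; exact: measurableT_comp.
have uz0 v : cell x l k v -> (0 <= (`|u v| * `|z v|)%:E)%E by rewrite lee_fin mulr_ge0.
have muzJ : measurable_fun (J : set lebR) (fun v => (`|u v| * `|z v|)%:E).
  exact: measurable_funS mC JC muz.
have uz0J v : J v -> (0 <= (`|u v| * `|z v|)%:E)%E by rewrite lee_fin mulr_ge0.
have hoelder := hoelder_variable p_exp q_exp pq_conj mC Pfin qfin.
have b1 : (\int[leb]_(v in (J : set lebR)) (phi (l / a k * w x tau v))%:E <=
    (vphi (l / a k))%:E * \int[leb]_(v in (J : set lebR)) (`|u v| * `|z v|)%:E)%E.
  rewrite -(ge0_integralZl_EFin leb mJ uz0J muzJ v0).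
  apply: ge0_le_integral_nonmeas => v Jv; rewrite -EFinM !lee_fin.
  rewrite (phi_ge0 (mulr_ge0 la0 (w0 _ Jv)))/=.
  apply: le_trans (phiw _ Jv) _; rewrite ler_wpM2l// ler_pM// ?ler_norm//.
    by rewrite phi_ge0 ?rnorm_ge0.
  by rewrite vphi_ge0// opnorm_pos// (Jx _ Jv).
have b2 : (\int[leb]_(v in (J : set lebR)) (`|u v| * `|z v|)%:E <=
    2%:E * (eps / Fk)%:E * qnorm x l k)%E.
  apply: le_trans (ge0_subset_integral leb mJ mC muz uz0 JC) _.
  apply: le_trans hoelder _; apply: lee_wpmul2r; first exact: Lp_norm_ge0.
  by apply: lee_wpmul2l => //; rewrite lee_fin.
have al0 : (0 <= (a k / l)%:E)%E by rewrite lee_fin divr_ge0// ltW.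
have v0E : (0 <= (vphi (l / a k))%:E)%E by rewrite lee_fin.
apply: le_trans (lee_wpmul2l al0 (le_trans b1 (lee_wpmul2l v0E b2))) _.
rewrite /term -/Fk; have := Lp_norm_ge0 (cell x l k) q z.
rewrite -/(qnorm x l k); case: (qnorm x l k) qfin => [n| |]// _ _.
rewrite -!EFinM lee_fin le_eqVlt; apply/orP; left; apply/eqP.
by field; rewrite !gt_eqF.
Qed.

Let G := convolution T g.

Lemma phi_convolution_diff_le (x tau l eps : R) : 0 < l -> 0 < eps ->
  (weyl_sup p phi F (reflection g) (- tau) l <= eps%:E)%E ->
  phi (rnorm (G (x + tau) - G x)) <= 2 / l * eps * fine (Hsum T vphi F q a l x).
Proof.
move=> l0 eps0 wsup.
have mw := @kernel_bound_measurable _ _ _ _ _ T_family g_meas x tau.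
have wfin := kernel_bound_finite T_family g_meas g_int x tau.
have Gle := rnorm_convolution_diff_le T_family g_meas g_int x tau.
have w0 v : - x < v -> 0 <= w x tau v.
  by move=> xv; rewrite mulr_ge0 ?rnorm_ge0 ?opnorm_pos.
have jensen := jensen_series phi_ge0 phi_convex phi_mono l0 a_gt0 a_sum mw w0 wfin.
have H0 : (0 <= Hsum T vphi F q a l x)%E.
  by apply: nneseries_ge0 => k _ _; exact: (term_ge0 x k l0).
have HE : (fine (Hsum T vphi F q a l x))%:E = Hsum T vphi F q a l x.
  by rewrite fineK// ge0_fin_numE// H_fin.
rewrite -lee_fin; apply: (@le_trans _ _ (phi (fine (\int[leb]_(v in
    (`](- x)%R, +oo[%classic : set lebR)) (w x tau v)%:E)))%:E).
  rewrite lee_fin; apply: phi_mono; first exact: rnorm_ge0.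
  rewrite -lee_fin fineK// ge0_fin_numE//; apply: integral_ge0 => v.
  by rewrite /= in_itv/= andbT lee_fin => /w0.
apply: le_trans jensen _.
rewrite EFinM HE -nneseriesZl; last by move=> k _; exact: (term_ge0 x k l0).
apply: lee_nneseries => k _.
  move=> _; apply: mule_ge0; first by rewrite lee_fin divr_ge0// ltW.
  apply: integral_ge0 => v; rewrite /= in_itv/= => /andP[h _].
  rewrite lee_fin phi_ge0// mulr_ge0//; first by rewrite divr_ge0// ltW.
  by apply: w0; apply: le_lt_trans h; rewrite lerDl mulr_ge0// ltW.
exact: cell_estimate.
Qed.

(** The number eps / F1 l t is one of those over which the Luxemburg norm of the
   difference of G is an infimum. *)
Lemma weyl_sup_convolution (tau l eps : R) : 0 < l -> 0 < eps ->
  (forall t, (\int[leb]_(x in `[t, (t + l)%R])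
    varphi (p x) (2 * l^-1 * fine (Hsum T vphi F q a l x) * F1 l t)%R <= 1)%E) ->
  (weyl_sup p phi F (reflection g) (- tau) l <= eps%:E)%E ->
  (weyl_sup p phi F1 G tau l <= eps%:E)%E.
Proof.
move=> l0 eps0 star wsup.
apply: ge_ereal_sup => _ [t _ <-].
have Fpos := F1_gt0 t l0.
rewrite -lee_pdivlMl// -EFinM mulrC; apply: Lp_norm_le; split.
- have md : measurable_fun (`[t, (t + l)%R]%classic : set lebR)
      (fun x => rnorm (G (x + tau) - G x)).
    apply: measurable_funTS.
    exact: (convolution_diff_measurable T_family g_meas g_int tau).
  exact: (monotone_comp_measurable phi_mono (measurable_itv_leb _) md (fun x _ => rnorm_ge0 _)).
- by rewrite divr_gt0.
apply: le_trans (star t); apply: ge0_le_integral_nonmeas => x _.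
rewrite varphi_ge0/=; apply: le_varphi; first exact: p_exp.2.
  by rewrite divr_ge0// ltW// divr_gt0.
have d0 : 0 <= phi (rnorm (G (x + tau) - G x)) by rewrite phi_ge0 ?rnorm_ge0.
rewrite /phi_diff ger0_norm// ler_pdivrMr ?divr_gt0//.
apply: le_trans (phi_convolution_diff_le x l0 eps0 wsup) _.
rewrite le_eqVlt; apply/orP; left; apply/eqP.
by field; rewrite !gt_eqF.
Qed.

(** Almost periods change sign under the reflection, hence so do the intervals in
   which they are sought. *)
Lemma reflected_interval (I : set R) (L : R) : is_interval I ->
  leb (I : set lebR) = L%:E ->
  is_interval ((fun x => 0 - x) @^-1` I) /\ leb ((fun x => 0 - x) @^-1` I : set lebR) = L%:E.
Proof.
move=> iI LI; split.
  move=> s t /= Is It u /andP[su ut]; apply: (iI _ _ It Is).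
  by rewrite !lerD2l !lerN2 su ut.
have mI : measurable (I : set lebR) by apply: borel_measurable_leb; exact: is_interval_measurable.
by have [_ ->] := measure_preserving_reflect 0 mI.
Qed.

Lemma equi_weyl_ap_convolution :
  (forall t l : R, 0 < l -> (\int[leb]_(x in `[t, (t + l)%R])
    varphi (p x) (2 * l^-1 * fine (Hsum T vphi F q a l x) * F1 l t)%R <= 1)%E) ->
  equi_weyl_ap p phi F (reflection g) -> equi_weyl_ap p phi F1 G.
Proof.
move=> star ap eps eps0; have [l [L [l0 L0 H]]] := ap _ eps0.
exists l, L; split; [exact: l0|exact: L0|move=> I iI LI].
have [iI' LI'] := reflected_interval iI LI.
have [tau Itau wsup] := H _ iI' LI'; exists (0 - tau); first exact: Itau.
apply: (weyl_sup_convolution l0 eps0 (fun t => star t l l0)).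
by rewrite sub0r opprK.
Qed.

Lemma weyl_ap_convolution :
  (exists2 l0, 0 < l0 & forall l t, l0 <= l -> (\int[leb]_(x in `[t, (t + l)%R])
    varphi (p x) (2 * l^-1 * fine (Hsum T vphi F q a l x) * F1 l t)%R <= 1)%E) ->
  weyl_ap p phi F (reflection g) -> weyl_ap p phi F1 G.
Proof.
move=> [l0 l00 star] ap eps eps0.
(* halving eps makes the bound on the limsup strict, hence valid for all large l *)
have e2 : 0 < eps / 2 by rewrite divr_gt0.
have [L L0 H] := ap _ e2.
exists L; first exact: L0.
move=> I iI LI; have [iI' LI'] := reflected_interval iI LI.
have [tau Itau wsup] := H _ iI' LI'; exists (0 - tau); first exact: Itau.
have : (limf_esup (weyl_sup p phi F (reflection g) tau) +oo%R < eps%:E)%E.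
  by apply: le_lt_trans wsup _; rewrite lte_fin; lra.
move=> /ereal_inf_lt[_ [V [M [Mr MV]] <-] supV].
apply: ge_ereal_inf; eexists.
  exists [set l | Num.max M l0 < l]; last reflexivity.
  by exists (Num.max M l0); split => //; exact: num_real.
apply: ge_ereal_sup => _ [l /= Ml <-].
move: Ml; rewrite gt_max => /andP[Ml l0l].
apply: (weyl_sup_convolution (lt_trans l00 l0l) eps0 (fun t => star l t (ltW l0l))).
rewrite sub0r opprK; apply: le_trans (ltW supV).
by apply: ereal_sup_ubound; exists l => //; exact: MV.
Qed.

End ConvolutionWeyl.

Theorem theorem4p1 (R : realType) (X Y : completeNormedModType R[i])
    (phi vphi : R -> R) (F F1 : R -> R -> R) (p q : R -> \bar R)
    (T : R -> {linear X -> Y}) (a : nat -> R) (g : R -> X)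
    (phi_ge0 : forall x : R, 0 <= x -> 0 <= phi x)
    (vphi_ge0 : forall x : R, 0 <= x -> 0 <= vphi x)
    (phi_convex : convex_function (`[0, +oo[ : set R^o) phi)
    (phi_mono : forall x y : R, 0 <= x -> x <= y -> phi x <= phi y)
    (phi_vphi : forall x y : R, 0 <= x -> 0 <= y -> phi (x * y) <= vphi x * phi y)
    (F_gt0 : forall l t : R, 0 < l -> 0 < F l t)
    (F1_gt0 : forall l t : R, 0 < l -> 0 < F1 l t)
    (p_exp : exponent p) (q_exp : exponent q)
    (pq_conj : forall x, ((p x)^-1 + (q x)^-1 = 1)%E)
    (T_family : strongly_continuous_family T)
    (a_gt0 : forall k, 0 < a k)
    (a_sum : (\sum_(0 <= k <oo) (a k)%:E = 1)%E)
    (g_meas : strongly_measurable (reflection g))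
    (g_int : forall x, (\int[leb]_(v in `](- x)%R, +oo[)
                (opnorm (T (v + x)) * rnorm (reflection g v))%:E < +oo)%E)
    (H_fin : forall x l : R, 0 < l -> (Hsum T vphi F q a l x < +oo)%E)
    (g_adm : weyl_admissible p phi (reflection g)) :
  let star l t :=
    (\int[leb]_(x in `[t, (t + l)%R])
       varphi (p x) (2 * l^-1 * fine (Hsum T vphi F q a l x) * F1 l t)%R <= 1)%E in
  (equi_weyl_ap p phi F (reflection g) ->
   (forall t l : R, 0 < l -> star l t) ->
   convolution_integrable T g /\ equi_weyl_ap p phi F1 (convolution T g))
  /\
  (weyl_ap p phi F (reflection g) ->
   (exists2 l0, 0 < l0 & forall l t, l0 <= l -> star l t) ->
   convolution_integrable T g /\ weyl_ap p phi F1 (convolution T g)).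
Proof.
have wd := convolution_well_defined T_family g_meas g_int.
move=> star; split=> [ap st|ap st]; split; try exact: wd.
  exact: (equi_weyl_ap_convolution phi_ge0 vphi_ge0 phi_convex phi_mono phi_vphi F_gt0
    F1_gt0 p_exp q_exp pq_conj T_family a_gt0 a_sum g_meas g_int H_fin st ap).
exact: (weyl_ap_convolution phi_ge0 vphi_ge0 phi_convex phi_mono phi_vphi F_gt0
  F1_gt0 p_exp q_exp pq_conj T_family a_gt0 a_sum g_meas g_int H_fin st ap).
Qed.
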